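(* Let $0<|a|<1$ and $\hat m_1,\hat m_2,f\in\mathbb{R}$. The mechanical billiard system defined on the hyperboloid model $\mathcal{H}_S$ of three-dimensional hyperbolic space by the hyperbolic Lagrange problem, with any finite combination (finite union) of confocal quadrics with foci at the two Kepler centers $Z_1,Z_2$ as reflection walls, is integrable. As subcases, the billiard systems with such walls defined on $\mathcal{H}_S$ by the hyperbolic two-center problem ($f=0$), by the hyperbolic Kepler problem ($\hat m_1=f=0$ or $\hat m_2=f=0$; one of the foci is then the Kepler center), and by the hyperbolic Hooke problem ($\hat m_1=\hat m_2=0$; the quadrics are then centered at the Hooke center) are integrable. The first integrals are $$E_{hyp}=\tfrac12\|q'\|_H^2-\frac{\hat m_1}{\tanh\theta_{Z_1}}-\frac{\hat m_2}{\tanh\theta_{Z_2}}-f\tanh^2\theta_{Z_0},$$ $$\hat E_{sp}=\frac{(q_4q_1'-q_1q_4')^2}{2(1-a^2)}+\frac{(q_4q_2'-q_2q_4')^2}{2}+\frac{(q_4q_3'-q_3q_4')^2}{2}-f\Big(\frac{q_1^2}{q_4^2(1-a^2)}+\frac{q_2^2+q_3^2}{q_4^2}\Big)-m_1\Big(\frac{(-q_1/q_4-a)^2}{1-a^2}+\frac{q_2^2+q_3^2}{q_4^2}\Big)^{-1/2}-m_2\Big(\frac{(-q_1/q_4+a)^2}{1-a^2}+\frac{q_2^2+q_3^2}{q_4^2}\Big)^{-1/2},$$ $$\hat L_{yz}=q_3q_2'-q_2q_3',$$ where $m_i=\hat m_i/\sqrt{1-a^2}$.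
   Context: A natural mechanical system $(M,g,U)$ is a Riemannian manifold $(M,g)$ with a force function $U$ (smooth outside a singular set); its motions satisfy $\nabla_{q'}q'=\mathrm{grad}_g U(q)$, where $'$ is the time derivative. A first integral is a function on $TM$ constant along motions. Poisson brackets of functions on $TM$ are those obtained from the canonical bracket of $T^*M$ via $v\mapsto g(v,\cdot)$. The elastic reflection at a point $q$ of a hypersurface $\mathcal{B}$ sends $v=v_t+v_n$ to $v'=v_t-v_n$ ($v_t$ tangent, $v_n$ $g$-normal to $\mathcal{B}$). The billiard system $(M,g,U,\mathcal{B})$, $\dim M=N$, is integrable if there are $N$ functionally independent first integrals of $(M,g,U)$ (differentials linearly independent on an open dense set), pairwise in involution, each satisfying $F(q,v)=F(q,v')$ for all reflections at $\mathcal{B}$. For a finite union of quadrics, reflections are considered at every point (outside singularities of $U$) of each quadric with respect to the tangent space of that quadric. $\mathbb{R}^{3,1}$ is $\mathbb{R}^4$ with the pseudo-Riemannian metric $dq_1^2+dq_2^2+dq_3^2-dq_4^2$, and $\mathcal{H}_S=\{q_1^2+q_2^2+q_3^2-q_4^2=-1,\ q_4<0\}$ with the induced Riemannian metric (norm $\|\cdot\|_H$ on tangent vectors). Kepler centers $Z_1=(\frac{a}{\sqrt{1-a^2}},0,0,-\frac1{\sqrt{1-a^2}})$, $Z_2=(-\frac{a}{\sqrt{1-a^2}},0,0,-\frac1{\sqrt{1-a^2}})$, Hooke center $Z_0=(0,0,0,-1)$. The hyperbolic Lagrange problem has force function $\hat m_1\coth\theta_{Z_1}+\hat m_2\coth\theta_{Z_2}+f\tanh^2\theta_{Z_0}$,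 where $\theta_Z$ is the hyperbolic angle (hyperbolic distance) between $q$ and $Z$. A quadric in $\mathcal{H}_S$ is confocal if it is non-degenerate and is the locus of points for which $\theta_{Z_1}+\theta_{Z_2}$ is a constant $c>d$ (spheroid), or $|\theta_{Z_1}-\theta_{Z_2}|$ is a constant $c$, $0<c<d$ (circular hyperboloid of two sheets), where $d$ is the hyperbolic distance between $Z_1$ and $Z_2$. *)

(* Defs.v *)
From HB Require Import structures.
From mathcomp Require Import all_boot all_order all_algebra.
From mathcomp Require Import all_classical all_reals all_analysis.

Set Implicit Arguments.
Unset Strict Implicit.
Unset Printing Implicit Defensive.

Import Order.TTheory GRing.Theory Num.Theory.
Import numFieldNormedType.Exports.

Local Open Scope classical_set_scope.
Local Open Scope ring_scope.

Section HyperbolicFunctions.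
Context {R : realType}.
Implicit Types x : R.

Definition cosh x : R := (expR x + expR (- x)) / 2.
Definition sinh x : R := (expR x - expR (- x)) / 2.
Definition tanh x : R := sinh x / cosh x.
Definition coth x : R := cosh x / sinh x.
Definition arcosh x : R := ln (x + Num.sqrt (x ^+ 2 - 1)).

End HyperbolicFunctions.

Section Hyperboloid.
Context {R : realType}.
Implicit Types (q v w : 'rV[R]_4) (x p : 'rV[R]_3).

Definition vec4 (r1 r2 r3 r4 : R) : 'rV[R]_4 :=
  \row_(i < 4) [:: r1; r2; r3; r4]`_i.

Definition co1 q : R := q ord0 (@Ordinal 4 0 isT).
Definition co2 q : R := q ord0 (@Ordinal 4 1 isT).
Definition co3 q : R := q ord0 (@Ordinal 4 2 isT).
Definition co4 q : R := q ord0 (@Ordinal 4 3 isT).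

Definition mink v w : R :=
  co1 v * co1 w + co2 v * co2 w + co3 v * co3 w - co4 v * co4 w.

Definition hyp : set 'rV[R]_4 := [set q | mink q q = -1 /\ co4 q < 0].

Definition tangent_hyp q v : Prop := mink q v = 0.

Definition normH v : R := Num.sqrt (mink v v).

(* Hyperbolic distance (angle) between two points of [hyp]. *)
Definition theta (Z q : 'rV[R]_4) : R := arcosh (- mink q Z).

(* A global chart of [hyp]: (q1, q2, q3) are coordinates, [chart] is the
   corresponding parametrization by 'rV_3 and [proj3] its inverse. *)
Definition chart x : 'rV[R]_4 :=
  let x1 := x ord0 (@Ordinal 3 0 isT) in
  let x2 := x ord0 (@Ordinal 3 1 isT) in
  let x3 := x ord0 (@Ordinal 3 2 isT) in
  vec4 x1 x2 x3 (- Num.sqrt (1 + x1 ^+ 2 + x2 ^+ 2 + x3 ^+ 2)).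

Definition proj3 q : 'rV[R]_3 := \row_(i < 3) [:: co1 q; co2 q; co3 q]`_i.

Definition basis3 (i : 'I_3) : 'rV[R]_3 := delta_mx ord0 i.

Definition metric_mx x : 'M[R]_3 :=
  \matrix_(i, j) mink ('d chart x (basis3 i)) ('d chart x (basis3 j)).

(* The inverse of v |-> g(v, .): the element of TM corresponding to the covector
   with canonical coordinates (x, p), i.e. the tangent vector v at [chart x] with
   p_i = g(v, d chart x e_i). *)
Definition of_cotangent (z : 'rV[R]_3 * 'rV[R]_3) : 'rV[R]_4 * 'rV[R]_4 :=
  (chart z.1, 'd chart (z.1) (z.2 *m invmx (metric_mx z.1))).

(* Functions on TM are represented by functions of (q, v) in R^4 x R^4, of which
   only the values at q in [hyp] and v tangent to [hyp] at q matter. *)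
Definition tm_fun := 'rV[R]_4 -> 'rV[R]_4 -> R.

Definition cotangent_fun (F : tm_fun) (z : 'rV[R]_3 * 'rV[R]_3) : R :=
  F (of_cotangent z).1 (of_cotangent z).2.

Definition poisson (F G : tm_fun) (z : 'rV[R]_3 * 'rV[R]_3) : R :=
  \sum_(i < 3)
    ('d (cotangent_fun F) z (basis3 i, 0) * 'd (cotangent_fun G) z (0, basis3 i)
   - 'd (cotangent_fun F) z (0, basis3 i) * 'd (cotangent_fun G) z (basis3 i, 0)).

(* G = grad_g U (q): G is tangent at q and g(G, .) = dU_q. *)
Definition is_gradient (U : 'rV[R]_4 -> R) q (G : 'rV[R]_4) : Prop :=
  tangent_hyp q G /\
  forall w : 'rV[R]_3,
    mink G ('d chart (proj3 q) w) = 'd (U \o chart) (proj3 q) w.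

(* Covariant acceleration of a curve in [hyp]: the Levi-Civita connection of a
   submanifold is the tangential part of the flat one, and the normal line at q
   is spanned by q, with mink q q = -1. *)
Definition cov_acc (c : R -> 'rV[R]_4) (t : R) : 'rV[R]_4 :=
  derive1 (derive1 c) t + mink (derive1 (derive1 c) t) (c t) *: c t.

(* Motions on the time interval ]s0, s1[ of (hyp, g, U), where U is singular at
   the points of S. *)
Definition is_motion (U : 'rV[R]_4 -> R) (S : set 'rV[R]_4) (s0 s1 : R)
    (c : R -> 'rV[R]_4) : Prop :=
  forall t : R, s0 < t < s1 ->
    [/\ hyp (c t) /\ ~ S (c t),
        derivable c t 1,
        derivable (derive1 c) t 1
      & is_gradient U (c t) (cov_acc c t)].

Definition first_integral (U : 'rV[R]_4 -> R) (S : set 'rV[R]_4) (F : tm_fun) :=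
  forall (s0 s1 : R) (c : R -> 'rV[R]_4), is_motion U S s0 s1 c ->
  forall t t' : R, s0 < t < s1 -> s0 < t' < s1 ->
    F (c t) (derive1 c t) = F (c t') (derive1 c t').

(* The phase space (TM minus the fibres over S), in canonical coordinates. *)
Definition phase_space (S : set 'rV[R]_4) : set ('rV[R]_3 * 'rV[R]_3) :=
  [set z | ~ S (chart z.1)].

Definition involutive (S : set 'rV[R]_4) (F G : tm_fun) : Prop :=
  forall z, phase_space S z -> poisson F G z = 0.

Definition indep_differentials (n : nat) (F : 'I_n -> tm_fun)
    (z : 'rV[R]_3 * 'rV[R]_3) : Prop :=
  forall k : 'I_n -> R,
    (forall w : 'rV[R]_3 * 'rV[R]_3,
      \sum_(i < n) k i * 'd (cotangent_fun (F i)) z w = 0) ->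
    forall i, k i = 0.

Definition functionally_independent (S : set 'rV[R]_4) (n : nat)
    (F : 'I_n -> tm_fun) : Prop :=
  (forall i z, phase_space S z -> differentiable (cotangent_fun (F i)) z) /\
  exists O : set ('rV[R]_3 * 'rV[R]_3),
    [/\ open O, O `<=` phase_space S, phase_space S `<=` closure O
      & forall z, O z -> indep_differentials F z].

(* Tangent vectors to a smooth submanifold B: velocities of curves in B. *)
Definition tangent_at (B : set 'rV[R]_4) q v : Prop :=
  exists c : R -> 'rV[R]_4,
    [/\ c 0 = q, \forall t \near (0 : R), B (c t) & is_derive (0 : R) 1 c v].

Definition normal_at (B : set 'rV[R]_4) q v : Prop :=
  tangent_hyp q v /\ forall w, tangent_at B q w -> mink v w = 0.

Definition reflection (B : set 'rV[R]_4) q v v' : Prop :=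
  exists vt vn : 'rV[R]_4,
    [/\ tangent_at B q vt, normal_at B q vn, v = vt + vn & v' = vt - vn].

Definition reflection_invariant (S : set 'rV[R]_4) (W : set (set 'rV[R]_4))
    (F : tm_fun) : Prop :=
  forall B, W B -> forall q, B q -> ~ S q ->
  forall v v', reflection B q v v' -> F q v = F q v'.

(* The wall is the union of the members of W, each one reflecting with respect to
   its own tangent spaces. *)
Definition billiard_integrable_by (U : 'rV[R]_4 -> R) (S : set 'rV[R]_4)
    (W : set (set 'rV[R]_4)) (F : 'I_3 -> tm_fun) : Prop :=
  [/\ forall i, first_integral U S (F i),
      functionally_independent S F,
      forall i j, involutive S (F i) (F j)
    & forall i, reflection_invariant S W (F i)].

Definition billiard_integrable (U : 'rV[R]_4 -> R) (S : set 'rV[R]_4)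
    (W : set (set 'rV[R]_4)) : Prop :=
  exists F : 'I_3 -> tm_fun, billiard_integrable_by U S W F.

End Hyperboloid.

Section LagrangeProblem.
Context {R : realType}.
Variable a : R.
Implicit Types (q v : 'rV[R]_4) (Q : set 'rV[R]_4).

Definition Z1 : 'rV[R]_4 :=
  vec4 (a / Num.sqrt (1 - a ^+ 2)) 0 0 (- (1 / Num.sqrt (1 - a ^+ 2))).
Definition Z2 : 'rV[R]_4 :=
  vec4 (- (a / Num.sqrt (1 - a ^+ 2))) 0 0 (- (1 / Num.sqrt (1 - a ^+ 2))).
Definition ZHooke : 'rV[R]_4 := vec4 0 0 0 (-1).

Definition kepler_force (Z : 'rV[R]_4) (mh : R) q : R := mh * coth (theta Z q).
Definition hooke_force (f : R) q : R := f * tanh (theta ZHooke q) ^+ 2.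
Definition two_center_force (mh1 mh2 : R) q : R :=
  kepler_force Z1 mh1 q + kepler_force Z2 mh2 q.
Definition lagrange_force (mh1 mh2 f : R) q : R :=
  kepler_force Z1 mh1 q + kepler_force Z2 mh2 q + hooke_force f q.

(* A center of zero mass is not a singularity: since 0 * y = 0, the corresponding
   term of the force function vanishes there as well. *)
Definition kepler_sing (Z : 'rV[R]_4) (mh : R) : set 'rV[R]_4 :=
  [set q | mh != 0 /\ q = Z].
Definition lagrange_sing (mh1 mh2 : R) : set 'rV[R]_4 :=
  kepler_sing Z1 mh1 `|` kepler_sing Z2 mh2.

Definition quadric (A : 'M[R]_4) : set 'rV[R]_4 :=
  [set q | hyp q /\ (q *m A *m q^T) ord0 ord0 = 0].

Definition nondegenerate_quadric Q : Prop :=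
  exists A : 'M[R]_4, [/\ A^T = A, \det A != 0 & Q = quadric A].

Definition focal_distance : R := theta Z1 Z2.

Definition spheroid (c : R) : set 'rV[R]_4 :=
  [set q | hyp q /\ theta Z1 q + theta Z2 q = c].
Definition two_sheeted_hyperboloid (c : R) : set 'rV[R]_4 :=
  [set q | hyp q /\ `|theta Z1 q - theta Z2 q| = c].

Definition confocal Q : Prop :=
  nondegenerate_quadric Q /\
  ((exists c, focal_distance < c /\ Q = spheroid c) \/
   (exists c, 0 < c < focal_distance /\ Q = two_sheeted_hyperboloid c)).

(* The geodesic symmetry of [hyp] about Z is q |-> - q - 2 <q, Z> Z. *)
Definition centered_at (Z : 'rV[R]_4) Q : Prop :=
  forall q, Q q -> Q (- q - (2 * mink q Z) *: Z).

Definition E_hyp (mh1 mh2 f : R) q v : R :=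
  normH v ^+ 2 / 2 - mh1 / tanh (theta Z1 q) - mh2 / tanh (theta Z2 q)
  - f * tanh (theta ZHooke q) ^+ 2.

Definition E_sp (mh1 mh2 f : R) q v : R :=
  let m1 := mh1 / Num.sqrt (1 - a ^+ 2) in
  let m2 := mh2 / Num.sqrt (1 - a ^+ 2) in
  let q1 := co1 q in let q2 := co2 q in let q3 := co3 q in let q4 := co4 q in
  let v1 := co1 v in let v2 := co2 v in let v3 := co3 v in let v4 := co4 v in
  (q4 * v1 - q1 * v4) ^+ 2 / (2 * (1 - a ^+ 2))
  + (q4 * v2 - q2 * v4) ^+ 2 / 2
  + (q4 * v3 - q3 * v4) ^+ 2 / 2
  - f * (q1 ^+ 2 / (q4 ^+ 2 * (1 - a ^+ 2)) + (q2 ^+ 2 + q3 ^+ 2) / q4 ^+ 2)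
  - m1 * (Num.sqrt ((- q1 / q4 - a) ^+ 2 / (1 - a ^+ 2)
                    + (q2 ^+ 2 + q3 ^+ 2) / q4 ^+ 2))^-1
  - m2 * (Num.sqrt ((- q1 / q4 + a) ^+ 2 / (1 - a ^+ 2)
                    + (q2 ^+ 2 + q3 ^+ 2) / q4 ^+ 2))^-1.

Definition L_yz q v : R := co3 q * co2 v - co2 q * co3 v.

Definition lagrange_integrals (mh1 mh2 f : R) (i : 'I_3) : @tm_fun R :=
  nth L_yz [:: E_hyp mh1 mh2 f; E_sp mh1 mh2 f; L_yz] i.

End LagrangeProblem.

(* Main.v *)
Require Import Defs.
From mathcomp Require Import all_boot all_order all_algebra.
From mathcomp Require Import all_classical all_reals all_analysis.
From mathcomp Require Import ring lra.
Import Order.TTheory GRing.Theory Num.Theory.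
Import numFieldNormedType.Exports.
Local Open Scope classical_set_scope.
Local Open Scope ring_scope.

(* In the chart x = (q1, q2, q3), with r = sqrt (1 + |x|^2) = - q4, the velocity
   with canonical momentum p is v = (p, 0) + (x.p) q.  Hence, with
   w = (1 / (1 - a^2), 1, 1), the integrals are
     (|p|^2 + (x.p)^2) / 2 - U(x),  r^2 (w1 p1^2 + p2^2 + p3^2) / 2 - V(x)
   and x3 p2 - x2 p3.  The first two commute, and the second is constant along the
   motions, as soon as r^2 w_i d_i U = d_i V + (x . grad V) x_i; this is linear
   in (U, V) and holds for the Kepler and Hooke terms, the second system being the
   central projection of the first one to an affine space.
   The vertical derivatives of the integrals have a determinant which is a nonzero
   polynomial, hence independence on a dense open set.
   The confocal quadrics are cut out by a quadratic equation in q1 and q4, so that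
   every solution of the linearized equation is the velocity of an explicit curve;
   the kinetic form of the second integral is represented by an endomorphism that
   preserves the tangent planes of these quadrics, so a tangent and a normal vector
   are orthogonal for it too, and reflections leave it invariant. *)

Set Implicit Arguments.
Unset Strict Implicit.
Unset Printing Implicit Defensive.

(** * Rules for computing differentials and velocities *)

Lemma is_diff_ext (R : realType) (V W : normedModType R) (f g df dg : V -> W) x :
  is_diff x f df -> f =1 g -> df =1 dg -> is_diff x g dg.
Proof. by move=> h /funext <- /funext <-. Qed.

Section Differentials.
Context {R : realType} {V : normedModType R}.
Implicit Types (f g df dg : V -> R) (x : V).

Lemma is_diff_const (k : R) x : is_diff x (fun=> k) (fun=> 0).
Proof. exact: is_diff_cst. Qed.

Lemma is_diff_add f g df dg x : is_diff x f df -> is_diff x g dg ->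
  is_diff x (fun y => f y + g y) (fun w => df w + dg w).
Proof. by move=> hf hg; exact: is_diffD. Qed.

Lemma is_diff_opp f df x : is_diff x f df ->
  is_diff x (fun y => - f y) (fun w => - df w).
Proof. by move=> hf; exact: is_diffN. Qed.

Lemma is_diff_mul f g df dg x : is_diff x f df -> is_diff x g dg ->
  is_diff x (fun y => f y * g y) (fun w => f x * dg w + g x * df w).
Proof. by move=> hf hg; exact: is_diffM. Qed.

Lemma is_diff_sqr f df x : is_diff x f df ->
  is_diff x (fun y => f y ^+ 2) (fun w => 2 * f x * df w).
Proof.
move=> hf; apply: is_diff_ext (is_diff_mul hf hf) _ _ => w; first by rewrite expr2.
by ring.
Qed.

Lemma is_diff_compR (h : R -> R) (dh : R) f df x :
  is_derive (f x) 1 h dh -> is_diff x f df ->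
  is_diff x (fun y => h (f y)) (fun w => dh * df w).
Proof.
move=> [hd hv] hf.
have hh : is_diff (f x) h (fun t => t * dh).
  split; first exact/derivable1_diffP.
  by rewrite deriv1E // derive1E hv; apply/funext.
apply: is_diff_ext (is_diff_comp hf hh) _ _ => w //=; exact: mulrC.
Qed.

Lemma is_diff_inv f df x : is_diff x f df -> f x != 0 ->
  is_diff x (fun y => (f y)^-1) (fun w => - df w / f x ^+ 2).
Proof.
move=> hf fx0.
have hV : is_derive (f x) 1 (fun t : R => t^-1) (- (f x) ^- 2 *: 1).
  exact: is_deriveV fx0 (is_derive_id _ _).
apply: is_diff_ext (is_diff_compR hV hf) _ _ => w //.
by rewrite /GRing.scale /= mulr1 mulNr mulNr mulrC.
Qed.

Lemma is_diff_sqrt f df x : is_diff x f df -> 0 < f x ->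
  is_diff x (fun y => Num.sqrt (f y)) (fun w => df w / (2 * Num.sqrt (f x))).
Proof.
move=> hf fx0; apply: is_diff_ext (is_diff_compR (is_derive1_sqrt fx0) hf) _ _.
  by [].
by move=> w; rewrite mulrC.
Qed.

Lemma is_diff_coord n (g dg : V -> 'rV[R]_n) (i : 'I_n) x : is_diff x g dg ->
  is_diff x (fun y => g y ord0 i) (fun w => dg w ord0 i).
Proof.
move=> hg.
have @f : {linear 'rV[R]_n -> R}.
  by exists (fun N : 'rV[R]_n => N ord0 i); do 2![eexists]; do ?[constructor];
     rewrite ?mxE// => ? *; rewrite ?mxE//; move=> ?; rewrite !mxE.
have hf : is_diff (g x) f f.
  split; first exact/linear_differentiable/coord_continuous.
  by rewrite diff_lin //; exact: coord_continuous.
exact: is_diff_comp hg hf.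
Qed.

Lemma is_diff_sum (W : normedModType R) (I : Type) (s : seq I) (F dF : I -> V -> W) x :
  (forall i, is_diff x (F i) (dF i)) ->
  is_diff x (fun y => \sum_(i <- s) F i y) (fun w => \sum_(i <- s) dF i w).
Proof.
move=> hF; elim: s => [|i s IH].
  by apply: is_diff_ext (is_diff_cst (0 : W) x) _ _ => y /=; rewrite big_nil.
by apply: is_diff_ext (is_diffD (hF i) IH) _ _ => y /=; rewrite big_cons.
Qed.

(** A row vector is the sum of its coordinates times the basis vectors, and each such term is
    differentiable. *)
Lemma is_diff_row n (g dg : V -> 'rV[R]_n) x :
  (forall i, is_diff x (fun y => g y ord0 i) (fun w => dg w ord0 i)) ->
  is_diff x g dg.
Proof.
move=> h.
have hs : is_diff x (fun y => \sum_i g y ord0 i *: delta_mx ord0 i : 'rV[R]_n)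
    (fun w => \sum_i dg w ord0 i *: delta_mx ord0 i).
  apply: is_diff_sum => i.
  exact: is_diff_comp (h i) (is_diff_scalel (g x ord0 i) (delta_mx ord0 i)).
by apply: is_diff_ext hs _ _ => y; rewrite -row_sum_delta.
Qed.

Lemma is_diff_vec4 (f1 f2 f3 f4 d1 d2 d3 d4 : V -> R) x :
  is_diff x f1 d1 -> is_diff x f2 d2 -> is_diff x f3 d3 -> is_diff x f4 d4 ->
  is_diff x (fun y => vec4 (f1 y) (f2 y) (f3 y) (f4 y))
            (fun w => vec4 (d1 w) (d2 w) (d3 w) (d4 w)).
Proof.
move=> h1 h2 h3 h4; apply: is_diff_row => -[[|[|[|[|//]]]] hi];
  [apply: is_diff_ext h1 _ _ | apply: is_diff_ext h2 _ _
  | apply: is_diff_ext h3 _ _ | apply: is_diff_ext h4 _ _ ];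
  by move=> y; rewrite mxE.
Qed.

End Differentials.

Lemma is_diff_derive1 (R : realType) (W : normedModType R) (c : R -> W) (t : R) :
  derivable c t 1 -> is_diff t c (fun h => h *: derive1 c t).
Proof.
move=> hc; split; first exact/derivable1_diffP.
by rewrite deriv1E.
Qed.

Lemma is_derive_of_is_diff (R : realType) (W : normedModType R) (c dc : R -> W)
  (t : R) : is_diff t c dc -> is_derive t 1 c (dc 1).
Proof.
move=> [hc hd]; have hdv : derivable c t 1 by exact: diff_derivable.
by split => //; rewrite deriveE // hd.
Qed.

Lemma is_diff_linear (R : realType) (V W : normedModType R)
  (f : {linear V -> W}) x : continuous f -> is_diff x f f.
Proof. by move=> cf; split; [exact: linear_differentiable | rewrite diff_lin]. Qed.

Lemma is_diff_fst (R : realType) (V W : normedModType R) (z : V * W) :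
  is_diff z fst fst.
Proof. by apply: is_diff_linear => ?; exact: cvg_fst. Qed.

Lemma is_diff_snd (R : realType) (V W : normedModType R) (z : V * W) :
  is_diff z snd snd.
Proof. by apply: is_diff_linear => ?; exact: cvg_snd. Qed.

(** * The chart, the metric and canonical momenta *)

Section Chart.
Context {R : realType}.
Implicit Types (x p w : 'rV[R]_3) (z : 'rV[R]_3 * 'rV[R]_3) (q v : 'rV[R]_4).

Definition ch1 x : R := x ord0 (@Ordinal 3 0 isT).
Definition ch2 x : R := x ord0 (@Ordinal 3 1 isT).
Definition ch3 x : R := x ord0 (@Ordinal 3 2 isT).

Definition dot3 x p : R := ch1 x * ch1 p + ch2 x * ch2 p + ch3 x * ch3 p.

Definition rad x : R := Num.sqrt (1 + ch1 x ^+ 2 + ch2 x ^+ 2 + ch3 x ^+ 2).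

Lemma co_vec4 (r1 r2 r3 r4 : R) : (co1 (vec4 r1 r2 r3 r4) = r1) *
  (co2 (vec4 r1 r2 r3 r4) = r2) * (co3 (vec4 r1 r2 r3 r4) = r3) *
  (co4 (vec4 r1 r2 r3 r4) = r4).
Proof. by rewrite /co1 /co2 /co3 /co4 !mxE. Qed.

Lemma vec4_eta q : q = vec4 (co1 q) (co2 q) (co3 q) (co4 q).
Proof.
apply/rowP => -[[|[|[|[|//]]]] hi]; rewrite !mxE /=;
  by congr (q _ _); apply/val_inj.
Qed.

Lemma ch_proj3 q : (ch1 (proj3 q) = co1 q) * (ch2 (proj3 q) = co2 q) *
  (ch3 (proj3 q) = co3 q).
Proof. by rewrite /ch1 /ch2 /ch3 !mxE. Qed.

Lemma ord3_ind (P : 'I_3 -> Prop) : P (@Ordinal 3 0 isT) ->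
  P (@Ordinal 3 1 isT) -> P (@Ordinal 3 2 isT) -> forall i, P i.
Proof.
move=> h0 h1 h2 [i hi]; case: i hi => [|[|[|//]]] hi.
- by rewrite (_ : Ordinal hi = @Ordinal 3 0 isT) //; apply/val_inj.
- by rewrite (_ : Ordinal hi = @Ordinal 3 1 isT) //; apply/val_inj.
- by rewrite (_ : Ordinal hi = @Ordinal 3 2 isT) //; apply/val_inj.
Qed.

Lemma sum_ord3 (F : 'I_3 -> R) : \sum_(i < 3) F i =
  F (@Ordinal 3 0 isT) + F (@Ordinal 3 1 isT) + F (@Ordinal 3 2 isT).
Proof.
rewrite !big_ord_recl big_ord0 addr0 addrA.
by congr (F _ + F _ + F _); apply/val_inj.
Qed.

Lemma ch_basis3 : (ch1 (basis3 (@Ordinal 3 0 isT) : 'rV[R]_3) = 1) *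
  (ch2 (basis3 (@Ordinal 3 0 isT) : 'rV[R]_3) = 0) *
  (ch3 (basis3 (@Ordinal 3 0 isT) : 'rV[R]_3) = 0) *
  (ch1 (basis3 (@Ordinal 3 1 isT) : 'rV[R]_3) = 0) *
  (ch2 (basis3 (@Ordinal 3 1 isT) : 'rV[R]_3) = 1) *
  (ch3 (basis3 (@Ordinal 3 1 isT) : 'rV[R]_3) = 0) *
  (ch1 (basis3 (@Ordinal 3 2 isT) : 'rV[R]_3) = 0) *
  (ch2 (basis3 (@Ordinal 3 2 isT) : 'rV[R]_3) = 0) *
  (ch3 (basis3 (@Ordinal 3 2 isT) : 'rV[R]_3) = 1).
Proof. by rewrite /ch1 /ch2 /ch3 /basis3 !mxE. Qed.

Lemma ch_zero : (ch1 (0 : 'rV[R]_3) = 0) * (ch2 (0 : 'rV[R]_3) = 0) *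
  (ch3 (0 : 'rV[R]_3) = 0).
Proof. by rewrite /ch1 /ch2 /ch3 !mxE. Qed.

Lemma rad_arg_gt0 x : 0 < 1 + ch1 x ^+ 2 + ch2 x ^+ 2 + ch3 x ^+ 2.
Proof. by rewrite !ltr_wpDr ?sqr_ge0. Qed.

Lemma rad_gt0 x : 0 < rad x.
Proof. by rewrite sqrtr_gt0 rad_arg_gt0. Qed.

Lemma rad_neq0 x : rad x != 0.
Proof. by rewrite gt_eqF // rad_gt0. Qed.

Lemma rad_sqr x : rad x ^+ 2 = 1 + ch1 x ^+ 2 + ch2 x ^+ 2 + ch3 x ^+ 2.
Proof. by rewrite sqr_sqrtr // ltW // rad_arg_gt0. Qed.

Lemma chartE x : chart x = vec4 (ch1 x) (ch2 x) (ch3 x) (- rad x).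
Proof. by []. Qed.

Lemma chartK q : hyp q -> chart (proj3 q) = q.
Proof.
move=> [hq h4]; rewrite [RHS]vec4_eta chartE /rad !ch_proj3; congr vec4.
rewrite (_ : 1 + _ + _ + _ = co4 q ^+ 2).
  by rewrite sqrtr_sqr ltr0_norm // opprK.
by move: hq; rewrite /mink; lra.
Qed.

Lemma is_diff_ch1 x : is_diff x ch1 ch1.
Proof. exact: (is_diff_coord _ (is_diff_id x)). Qed.
Lemma is_diff_ch2 x : is_diff x ch2 ch2.
Proof. exact: (is_diff_coord _ (is_diff_id x)). Qed.
Lemma is_diff_ch3 x : is_diff x ch3 ch3.
Proof. exact: (is_diff_coord _ (is_diff_id x)). Qed.

Lemma is_diff_rad x : is_diff x rad (fun w => dot3 x w / rad x).
Proof.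
have h : is_diff x (fun y => 1 + ch1 y ^+ 2 + ch2 y ^+ 2 + ch3 y ^+ 2) _ :=
  is_diff_add (is_diff_add (is_diff_add (is_diff_const 1 x)
    (is_diff_sqr (is_diff_ch1 x))) (is_diff_sqr (is_diff_ch2 x)))
    (is_diff_sqr (is_diff_ch3 x)).
apply: is_diff_ext (is_diff_sqrt h (rad_arg_gt0 x)) _ _ => // w.
by rewrite -/(rad x) /dot3; field; rewrite rad_neq0.
Qed.

Definition dchart x w : 'rV[R]_4 :=
  vec4 (ch1 w) (ch2 w) (ch3 w) (- (dot3 x w / rad x)).

Lemma is_diff_chart x : is_diff x chart (dchart x).
Proof.
exact: (is_diff_vec4 (is_diff_ch1 x) (is_diff_ch2 x) (is_diff_ch3 x)
  (is_diff_opp (is_diff_rad x))).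
Qed.

Lemma diff_chartE x : 'd chart x = dchart x :> (_ -> _).
Proof. by have h := is_diff_chart x; rewrite diff_val. Qed.

(** In the chart the metric is the rank-one perturbation [I - x^T x / r^2] of the identity; since
    [r^2 = 1 + |x|^2], its inverse is [I + x^T x]. *)
Definition inv_metric x : 'M[R]_3 :=
  \matrix_(i, j) ((i == j)%:R + x ord0 i * x ord0 j).

Lemma mul_metric_inv x : metric_mx x *m inv_metric x = 1%:M.
Proof.
have rN0 := rad_neq0 x.
have metricE i j : metric_mx x i j =
    (i == j)%:R - x ord0 i * x ord0 j / rad x ^+ 2.
  rewrite /metric_mx !mxE !diff_chartE /mink /dchart !co_vec4.
  move: i j; apply: ord3_ind; apply: ord3_ind;
  rewrite /dot3 !ch_basis3 -/(ch1 x) -/(ch2 x) -/(ch3 x) /=;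
  by field.
apply/matrixP => i j; rewrite !mxE.
have -> : \sum_k metric_mx x i k * inv_metric x k j =
   \sum_k ((i == k)%:R * (inv_metric x k j)
     - x ord0 i / rad x ^+ 2 * (x ord0 k * inv_metric x k j)).
  by apply: eq_bigr => k _; rewrite metricE; field.
rewrite sumrB -mulr_sumr (bigD1 i) //= eqxx mul1r big1 ?addr0; last first.
  by move=> k /negbTE ki; rewrite eq_sym ki mul0r.
have -> : \sum_k x ord0 k * inv_metric x k j = x ord0 j * rad x ^+ 2.
  rewrite (eq_bigr (fun k => (k == j)%:R * x ord0 k + x ord0 k ^+ 2 * x ord0 j)).
    rewrite big_split /= -mulr_suml (bigD1 j) //= eqxx mul1r big1 ?addr0.
      by rewrite rad_sqr sum_ord3 -/(ch1 x) -/(ch2 x) -/(ch3 x); ring.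
    by move=> k /negbTE ki; rewrite ki mul0r.
  by move=> k _; rewrite /inv_metric !mxE; ring.
by rewrite /inv_metric !mxE; field.
Qed.

Definition velocity x p : 'rV[R]_4 :=
  vec4 (ch1 p + dot3 x p * ch1 x) (ch2 p + dot3 x p * ch2 x)
    (ch3 p + dot3 x p * ch3 x) (- (dot3 x p * rad x)).

(** Raising the index of [p] gives [p + (x.p) x]; its scalar product with [x] is [(x.p) r^2], so the
    fourth coordinate of the lift is [- (x.p) r]. *)
Lemma of_cotangentE z : of_cotangent z = (chart z.1, velocity z.1 z.2).
Proof.
case: z => x p; rewrite /of_cotangent /=; congr pair; rewrite diff_chartE.
have [um _] := mulmx1_unit (mul_metric_inv x).
have -> : invmx (metric_mx x) = inv_metric x.
  by rewrite -[RHS](mulKmx um) mul_metric_inv mulmx1.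
have chm : forall i, (p *m inv_metric x) ord0 i = p ord0 i + dot3 x p * x ord0 i.
  apply: ord3_ind; rewrite !mxE sum_ord3 !mxE /= /dot3 -?/(ch1 _) -?/(ch2 _) -?/(ch3 _);
    by ring.
have rN0 := rad_neq0 x; have rS := rad_sqr x.
rewrite /velocity /dchart [dot3 x (_ *m _)]/dot3.
rewrite [ch1 (_ *m _)]chm [ch2 (_ *m _)]chm [ch3 (_ *m _)]chm -!/(ch1 _) -!/(ch2 _) -!/(ch3 _).
congr vec4; congr (- _); apply: (mulIf rN0); rewrite mulfVK // -mulrA -expr2 rS.
by rewrite /dot3; ring.
Qed.

Lemma mink_velocity x p : mink (velocity x p) (velocity x p) =
  dot3 p p + dot3 x p ^+ 2.
Proof.
have rS := rad_sqr x.
rewrite /mink /velocity !co_vec4 mulrNN -expr2 -[X in _ - X]/(_ ^+ 2) exprMn rS /dot3; ring.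
Qed.

End Chart.

(** * Pairs of dual potentials and the Poisson brackets of the integrals *)

Section DualPotentials.
Context {R : realType}.
Variable a : R.
Hypothesis a2_lt1 : 0 < 1 - a ^+ 2.
Implicit Types (x p : 'rV[R]_3) (z : 'rV[R]_3 * 'rV[R]_3) (q v : 'rV[R]_4).

Definition vec3 (r1 r2 r3 : R) : 'rV[R]_3 := \row_(i < 3) [:: r1; r2; r3]`_i.

Lemma ch_vec3 (r1 r2 r3 : R) : (ch1 (vec3 r1 r2 r3) = r1) *
  (ch2 (vec3 r1 r2 r3) = r2) * (ch3 (vec3 r1 r2 r3) = r3).
Proof. by rewrite /ch1 /ch2 /ch3 !mxE. Qed.

Lemma chD x p : (ch1 (x + p) = ch1 x + ch1 p) * (ch2 (x + p) = ch2 x + ch2 p) *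
  (ch3 (x + p) = ch3 x + ch3 p).
Proof. by rewrite /ch1 /ch2 /ch3 !mxE. Qed.

Lemma chZ (k : R) x : (ch1 (k *: x) = k * ch1 x) * (ch2 (k *: x) = k * ch2 x) *
  (ch3 (k *: x) = k * ch3 x).
Proof. by rewrite /ch1 /ch2 /ch3 !mxE. Qed.

Lemma chN x : (ch1 (- x) = - ch1 x) * (ch2 (- x) = - ch2 x) *
  (ch3 (- x) = - ch3 x).
Proof. by rewrite /ch1 /ch2 /ch3 !mxE. Qed.

(* Central projection of [hyp] from the origin, together with the time change by
   [q4 ^ -2], turns the force function [U] into the force function [V] for the
   constant metric [diag (1 / (1 - a^2), 1, 1)]. *)
Definition dual_potentials (U V : 'rV[R]_4 -> R) x : Prop :=
  exists u y : 'rV[R]_3,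
    [/\ is_diff x (U \o chart) (dot3 u), is_diff x (V \o chart) (dot3 y),
        [/\ rad x ^+ 2 * ch1 u = (1 - a ^+ 2) * (ch1 y + dot3 x y * ch1 x),
            rad x ^+ 2 * ch2 u = ch2 y + dot3 x y * ch2 x
          & rad x ^+ 2 * ch3 u = ch3 y + dot3 x y * ch3 x],
        ch3 x * ch2 u = ch2 x * ch3 u
      & ch3 x * ch2 y = ch2 x * ch3 y].

(** Nothing is asked of [U] and [V] at [x]: a center of zero mass is harmless even at the center
    itself. *)
Lemma dual_potentials_null U V x :
  dual_potentials (fun q => 0 * U q) (fun q => 0 * V q) x.
Proof.
have h (F : 'rV[R]_4 -> R) : is_diff x ((fun q => 0 * F q) \o chart)
    (dot3 (0 : 'rV[R]_3)).
  apply: is_diff_ext (is_diff_const 0 x) _ _ => w /=; first by rewrite mul0r.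
  by rewrite /dot3 !ch_zero; ring.
exists 0, 0; split; [exact (h U) | exact (h V) | | |]; rewrite /dot3 !ch_zero;
  try split; ring.
Qed.

Lemma dual_potentialsZ (k : R) U V x : dual_potentials U V x ->
  dual_potentials (fun q => k * U q) (fun q => k * V q) x.
Proof.
move=> [u [y [hu hv [e1 e2 e3] ru ry]]].
exists (k *: u), (k *: y); split.
- apply: is_diff_ext (is_diff_mul (is_diff_const k x) hu) _ _ => w //=.
  by rewrite /dot3 !chZ; ring.
- apply: is_diff_ext (is_diff_mul (is_diff_const k x) hv) _ _ => w //=.
  by rewrite /dot3 !chZ; ring.
- move: e1 e2 e3; rewrite /dot3 !chZ => e1 e2 e3.
  by split; rewrite mulrCA ?e1 ?e2 ?e3; ring.
- by rewrite !chZ mulrCA ru; ring.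
- by rewrite !chZ mulrCA ry; ring.
Qed.

Lemma dual_potentialsD U1 V1 U2 V2 x : dual_potentials U1 V1 x ->
  dual_potentials U2 V2 x ->
  dual_potentials (fun q => U1 q + U2 q) (fun q => V1 q + V2 q) x.
Proof.
move=> [u [y [hu hv [e1 e2 e3] ru ry]]] [u' [y' [hu' hv' [e1' e2' e3'] ru' ry']]].
exists (u + u'), (y + y'); split.
- apply: is_diff_ext (is_diff_add hu hu') _ _ => w //=.
  by rewrite /dot3 !chD; ring.
- apply: is_diff_ext (is_diff_add hv hv') _ _ => w //=.
  by rewrite /dot3 !chD; ring.
- move: e1 e2 e3 e1' e2' e3'; rewrite /dot3 !chD => e1 e2 e3 e1' e2' e3'.
  by split; rewrite mulrDr ?e1 ?e2 ?e3 ?e1' ?e2' ?e3'; ring.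
- by rewrite !chD !mulrDr ru ru'.
- by rewrite !chD !mulrDr ry ry'.
Qed.

Definition mechanical_energy (U : 'rV[R]_4 -> R) : @tm_fun R :=
  fun q v => normH v ^+ 2 / 2 - U q.

Definition projective_energy (V : 'rV[R]_4 -> R) : @tm_fun R := fun q v =>
  (co4 q * co1 v - co1 q * co4 v) ^+ 2 / (2 * (1 - a ^+ 2))
  + (co4 q * co2 v - co2 q * co4 v) ^+ 2 / 2
  + (co4 q * co3 v - co3 q * co4 v) ^+ 2 / 2 - V q.

Definition wt p w : R := ch1 p * ch1 w / (1 - a ^+ 2) + ch2 p * ch2 w + ch3 p * ch3 w.

Lemma dot3_ge0 p : 0 <= dot3 p p.
Proof. by rewrite /dot3 -!expr2 !addr_ge0 ?sqr_ge0. Qed.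

Lemma cotangent_mechanical U z : cotangent_fun (mechanical_energy U) z =
  (dot3 z.2 z.2 + dot3 z.1 z.2 ^+ 2) / 2 - U (chart z.1).
Proof.
rewrite /cotangent_fun of_cotangentE /= /mechanical_energy /normH mink_velocity.
by rewrite sqr_sqrtr // addr_ge0 ?sqr_ge0 ?dot3_ge0.
Qed.

(** For the velocity of momentum [p], [q4 v_i - q_i v4 = - r p_i]: the terms in [x.p] cancel. *)
Lemma cotangent_projective V z : cotangent_fun (projective_energy V) z =
  rad z.1 ^+ 2 * wt z.2 z.2 / 2 - V (chart z.1).
Proof.
rewrite /cotangent_fun of_cotangentE /= /projective_energy /velocity chartE !co_vec4.
by rewrite /wt; field; rewrite gt_eqF.
Qed.

Lemma cotangent_L z : cotangent_fun (@L_yz R) z =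
  ch3 z.1 * ch2 z.2 - ch2 z.1 * ch3 z.2.
Proof.
rewrite /cotangent_fun of_cotangentE /= /L_yz /velocity chartE !co_vec4; ring.
Qed.

Lemma is_diff_fst_comp (f df : 'rV[R]_3 -> R) z : is_diff (z.1) f df ->
  is_diff z (fun z => f z.1) (fun w => df w.1).
Proof. by move=> h; exact: is_diff_comp (is_diff_fst z) h. Qed.

Lemma is_diff_snd_comp (f df : 'rV[R]_3 -> R) z : is_diff (z.2) f df ->
  is_diff z (fun z => f z.2) (fun w => df w.2).
Proof. by move=> h; exact: is_diff_comp (is_diff_snd z) h. Qed.

(** Differentiation directed by the syntax of the function. The differential is left to unification,
    and is compared afterwards with the stated one through [is_diff_ext]. *)
Ltac diff_step := first
  [ match goal with h : is_diff _ (_ \o chart) _ |- _ => exact (is_diff_fst_comp h) end |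
    eapply is_diff_fst_comp; first [exact: is_diff_ch1 | exact: is_diff_ch2
      | exact: is_diff_ch3 | exact: is_diff_rad ]
  | eapply is_diff_snd_comp; first [exact: is_diff_ch1 | exact: is_diff_ch2
      | exact: is_diff_ch3]
  | exact: is_diff_const | eapply is_diff_opp | eapply is_diff_add
  | eapply is_diff_sqr | eapply is_diff_mul ].

Lemma is_diff_mechanical U z u : is_diff (z.1) (U \o chart) (dot3 u) ->
  is_diff z (cotangent_fun (mechanical_energy U))
   (fun w => dot3 z.2 w.2 + dot3 z.1 z.2 * (dot3 z.1 w.2 + dot3 z.2 w.1) - dot3 u w.1).
Proof.
move=> hu; rewrite (funext (cotangent_mechanical U)) /dot3.
eapply is_diff_ext; [| by [] |].
  repeat diff_step.
move=> w /=; rewrite /dot3 /=; by field.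
Qed.

Lemma is_diff_projective V z y : is_diff (z.1) (V \o chart) (dot3 y) ->
  is_diff z (cotangent_fun (projective_energy V))
   (fun w => dot3 z.1 w.1 * wt z.2 z.2 + rad z.1 ^+ 2 * wt z.2 w.2 - dot3 y w.1).
Proof.
move=> hu; rewrite (funext (cotangent_projective V)) /wt.
eapply is_diff_ext; [| by [] |].
  repeat diff_step.
move=> w /=; rewrite /dot3 /=; field; by rewrite rad_neq0 gt_eqF.
Qed.

Lemma is_diff_L z : is_diff z (cotangent_fun (@L_yz R))
  (fun w => ch3 z.1 * ch2 w.2 + ch3 w.1 * ch2 z.2
            - (ch2 z.1 * ch3 w.2 + ch2 w.1 * ch3 z.2)).
Proof.
rewrite (funext cotangent_L).
eapply is_diff_ext; [| by [] |].
  repeat diff_step.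
move=> w /=; ring.
Qed.

Lemma poissonC (F G : @tm_fun R) z : poisson F G z = - poisson G F z.
Proof.
rewrite /poisson -sumrN; apply: eq_bigr => i _.
by rewrite opprB; congr (_ - _); exact: mulrC.
Qed.

Lemma poisson_self (F : @tm_fun R) z : poisson F F z = 0.
Proof. by rewrite /poisson big1 // => i _; rewrite mulrC subrr. Qed.

Lemma poisson_energies U V z : dual_potentials U V z.1 ->
  poisson (mechanical_energy U) (projective_energy V) z = 0.
Proof.
move=> [u [y [/is_diff_mechanical [_ hu] /is_diff_projective [_ hv] [e1 e2 e3] ru ry]]].
rewrite /poisson hu hv sum_ord3 /= /dot3 /wt !ch_basis3 !ch_zero.
have rS := rad_sqr z.1.
have aN0 : 1 - a ^+ 2 != 0 by rewrite gt_eqF.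
set s := dot3 z.1 z.2; set k := wt z.2 z.2.
(* The bracket splits into a part cubic in the momentum, which is a multiple of [r^2 - (1 + |x|^2)],
   and a part linear in it, which is a combination of the three duality equations. *)
apply: (@etrans _ _ (s * k * (rad z.1 ^+ 2 - (1 + ch1 z.1 ^+ 2 + ch2 z.1 ^+ 2 + ch3 z.1 ^+ 2))
  + ch1 z.2 / (1 - a ^+ 2) * ((1 - a ^+ 2) * (ch1 y + dot3 z.1 y * ch1 z.1) - rad z.1 ^+ 2 * ch1 u)
  + ch2 z.2 * (ch2 y + dot3 z.1 y * ch2 z.1 - rad z.1 ^+ 2 * ch2 u)
  + ch3 z.2 * (ch3 y + dot3 z.1 y * ch3 z.1 - rad z.1 ^+ 2 * ch3 u))).
  by rewrite /s /k /wt /dot3; field.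
by rewrite e1 e2 e3 rS !subrr !mulr0 !addr0.
Qed.

(** [L_yz] generates the rotations about the first axis, which preserve the kinetic term; what
    remains of the bracket is the torque of the force about this axis. *)
Lemma poisson_mechanical_L U V z : dual_potentials U V z.1 ->
  poisson (mechanical_energy U) (@L_yz R) z = 0.
Proof.
move=> [u [y [/is_diff_mechanical [_ hu] _ _ ru _]]].
have [_ hL] := is_diff_L z.
rewrite /poisson hu hL sum_ord3 /= /dot3 !ch_basis3 !ch_zero.
apply: (@etrans _ _ ((ch3 z.1 * ch2 u - ch2 z.1 * ch3 u) * -1)).
  by ring.
by rewrite ru subrr mul0r.
Qed.

Lemma poisson_projective_L U V z : dual_potentials U V z.1 ->
  poisson (projective_energy V) (@L_yz R) z = 0.
Proof.
move=> [u [y [_ /is_diff_projective [_ hv] _ _ ry]]].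
have [_ hL] := is_diff_L z.
rewrite /poisson hv hL sum_ord3 /= /dot3 /wt !ch_basis3 !ch_zero.
apply: (@etrans _ _ ((ch3 z.1 * ch2 y - ch2 z.1 * ch3 y) * -1)).
  by field; rewrite gt_eqF.
by rewrite ry subrr mul0r.
Qed.
End DualPotentials.

(** * Conservation of the three integrals along motions *)

Section FirstIntegrals.
Context {R : realType}.
Variable a : R.
Hypothesis a2_lt1 : 0 < 1 - a ^+ 2.
Implicit Types (x : 'rV[R]_3) (q v w : 'rV[R]_4).

(** [Ft] is a form of the integral to which the differentiation rules apply: the square root of
    [normH] is removed and the potentials are read through the chart. It needs to agree with [F]
    only on the time interval, as the curve is arbitrary elsewhere. *)
Lemma constant_on_interval (s0 s1 : R) (F Ft : R -> R) :
  (forall t, s0 < t < s1 -> Ft t = F t) ->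
  (forall t, s0 < t < s1 -> is_diff t Ft (fun=> 0)) ->
  forall t t', s0 < t < s1 -> s0 < t' < s1 -> F t = F t'.
Proof.
move=> eqF dF.
have main t t' : s0 < t < s1 -> s0 < t' < s1 -> t <= t' -> Ft t = Ft t'.
  move=> /andP[t0 t1] /andP[t0' t1'] tt'.
  have dF' (y : R) : t <= y <= t' -> is_derive y 1 Ft 0.
    move=> /andP[ty yt']; apply: (is_derive_of_is_diff (dF y _)).
    by rewrite (lt_le_trans t0 ty) (le_lt_trans yt' t1').
  have [y||y _] := @MVT_segment R Ft (fun=> 0) t t' tt'.
  - by rewrite in_itv /= => /andP[/ltW ty /ltW yt']; apply: dF'; rewrite ty yt'.
  - apply: derivable_within_continuous => y; rewrite in_itv /= => hy.
    by have [] := dF' _ hy.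
  - by rewrite mul0r => /eqP; rewrite subr_eq0 => /eqP ->.
move=> t t' ht ht'; rewrite -!eqF //.
by case: (leP t t') => [/main -> //|/ltW /main ->].
Qed.

Lemma is_diff_co (c : R -> 'rV[R]_4) t : derivable c t 1 ->
  [/\ is_diff t (fun y => co1 (c y)) (fun h => h * co1 (derive1 c t)),
      is_diff t (fun y => co2 (c y)) (fun h => h * co2 (derive1 c t)),
      is_diff t (fun y => co3 (c y)) (fun h => h * co3 (derive1 c t))
    & is_diff t (fun y => co4 (c y)) (fun h => h * co4 (derive1 c t))].
Proof.
move=> /is_diff_derive1 hc.
by split; (apply: is_diff_ext (is_diff_coord _ hc) _ _ => // h; rewrite mxE).
Qed.

Lemma is_diff_proj3 (c : R -> 'rV[R]_4) t : derivable c t 1 ->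
  is_diff t (fun y => proj3 (c y)) (fun h => h *: proj3 (derive1 c t)).
Proof.
move=> /is_diff_co [h1 h2 h3 _]; apply: is_diff_row; apply: ord3_ind;
  [apply: is_diff_ext h1 _ _ | apply: is_diff_ext h2 _ _
  | apply: is_diff_ext h3 _ _]; by move=> y; rewrite !mxE.
Qed.

Lemma is_diff_near_const (g dg : R -> R) (k t : R) :
  is_diff t g dg -> (\forall y \near t, g y = k) -> dg 1 = 0.
Proof.
move=> /is_derive_of_is_diff [_ <-] gk.
by rewrite (@near_eq_derive _ _ _ g (cst k)) // derive_cst.
Qed.

Lemma velocity_tangent (c : R -> 'rV[R]_4) (s0 s1 t : R) :
  (forall y, s0 < y < s1 -> hyp (c y)) -> s0 < t < s1 -> derivable c t 1 ->
  mink (c t) (derive1 c t) = 0.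
Proof.
move=> hc ht /is_diff_co [h1 h2 h3 h4].
have hm := is_diff_add (is_diff_add (is_diff_add (is_diff_sqr h1) (is_diff_sqr h2))
  (is_diff_sqr h3)) (is_diff_opp (is_diff_sqr h4)).
suff /(is_diff_near_const hm) : \forall y \near t,
    co1 (c y) ^+ 2 + co2 (c y) ^+ 2 + co3 (c y) ^+ 2 - co4 (c y) ^+ 2 = -1.
  by rewrite /mink; lra.
near=> y; have [hy _] : hyp (c y).
  by apply: hc; apply/andP; split; near: y;
    [apply: lt_nbhsr; case/andP: ht | apply: lt_nbhsl; case/andP: ht].
by move: hy; rewrite /mink /= ; lra.
Unshelve. all: by end_near. Qed.

Lemma tangent_dchart q v : hyp q -> mink q v = 0 -> v = dchart (proj3 q) (proj3 v).
Proof.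
move=> hq hv; rewrite [LHS]vec4_eta /dchart !ch_proj3; congr vec4.
have r0 := rad_neq0 (proj3 q).
have q4 : co4 q = - rad (proj3 q) by rewrite -{1}(chartK hq) chartE co_vec4.
apply: (mulfI r0); rewrite mulrN mulrCA mulfV // mulr1 /dot3 !ch_proj3.
by move: hv; rewrite /mink q4; lra.
Qed.

(** With [w] the first three coordinates of [v], Lagrange's identity gives
    [r^2 <v, v> = |w|^2 + |x cross w|^2], which makes the induced metric positive. *)
Lemma mink_tangent_ge0 q v : hyp q -> mink q v = 0 -> 0 <= mink v v.
Proof.
move=> hq hv; set x := proj3 q; set w := proj3 v.
have r0 := rad_gt0 x.
rewrite (tangent_dchart hq hv) /mink /dchart !co_vec4 -/x -/w mulrNN.
have -> : dot3 x w / rad x * (dot3 x w / rad x) = dot3 x w ^+ 2 / rad x ^+ 2.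
  by field; rewrite gt_eqF.
rewrite subr_ge0 ler_pdivrMr ?exprn_gt0 // rad_sqr -subr_ge0.
rewrite (_ : _ - _ = dot3 w w + ((ch1 x * ch2 w - ch2 x * ch1 w) ^+ 2
  + (ch1 x * ch3 w - ch3 x * ch1 w) ^+ 2 + (ch2 x * ch3 w - ch3 x * ch2 w) ^+ 2)).
  by rewrite addr_ge0 ?dot3_ge0 // !addr_ge0 ?sqr_ge0.
by rewrite /dot3; ring.
Qed.

Lemma minkDl q v w : mink (q + v) w = mink q w + mink v w.
Proof. by rewrite /mink /co1 /co2 /co3 /co4 !mxE; ring. Qed.

Lemma minkZl (k : R) q v : mink (k *: q) v = k * mink q v.
Proof. by rewrite /mink /co1 /co2 /co3 /co4 !mxE; ring. Qed.

Lemma minkC q v : mink q v = mink v q.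
Proof. by rewrite /mink; ring. Qed.

(* [q], [v], [A] stand for position, velocity and acceleration, and [u], [y] for the
   gradients of dual potentials: the power of the force in the projected system is
   the derivative of [V]. *)
Lemma projective_power (s h q1 q2 q3 q4 v1 v2 v3 v4 A1 A2 A3 A4 u1 u2 u3 y1 y2 y3 : R) :
  q4 != 0 -> s != 0 ->
  A1 * q4 - A4 * q1 = u1 * q4 -> A2 * q4 - A4 * q2 = u2 * q4 ->
  A3 * q4 - A4 * q3 = u3 * q4 ->
  q1 * v1 + q2 * v2 + q3 * v3 - q4 * v4 = 0 ->
  q1 * q1 + q2 * q2 + q3 * q3 - q4 * q4 = -1 ->
  q4 ^+ 2 * u1 = s * (y1 + (q1 * y1 + q2 * y2 + q3 * y3) * q1) ->
  q4 ^+ 2 * u2 = y2 + (q1 * y1 + q2 * y2 + q3 * y3) * q2 ->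
  q4 ^+ 2 * u3 = y3 + (q1 * y1 + q2 * y2 + q3 * y3) * q3 ->
  (2 * s)^-1 *
  (2 * (q4 * v1 - q1 * v4) *
   (q4 * (h * A1) + v1 * (h * v4) - (q1 * (h * A4) + v4 * (h * v1)))) +
  2^-1 *
  (2 * (q4 * v2 - q2 * v4) *
   (q4 * (h * A2) + v2 * (h * v4) - (q2 * (h * A4) + v4 * (h * v2)))) +
  2^-1 *
  (2 * (q4 * v3 - q3 * v4) *
   (q4 * (h * A3) + v3 * (h * v4) - (q3 * (h * A4) + v4 * (h * v3)))) -
  h * (y1 * v1 + y2 * v2 + y3 * v3) = 0.
Proof.
move=> q4N0 sN0 a1 a2 a3 hv hq e1 e2 e3.
set D := q1 * y1 + q2 * y2 + q3 * y3 in e1 e2 e3.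
have c1 : q4 * (A1 * q4 - A4 * q1) = s * (y1 + D * q1) by rewrite -e1 a1; ring.
have c2 : q4 * (A2 * q4 - A4 * q2) = y2 + D * q2 by rewrite -e2 a2; ring.
have c3 : q4 * (A3 * q4 - A4 * q3) = y3 + D * q3 by rewrite -e3 a3; ring.
apply: (mulfI q4N0); rewrite mulr0.
transitivity (h * ((q4 * v1 - q1 * v4) * (q4 * (A1 * q4 - A4 * q1)) / s
  + (q4 * v2 - q2 * v4) * (q4 * (A2 * q4 - A4 * q2))
  + (q4 * v3 - q3 * v4) * (q4 * (A3 * q4 - A4 * q3))
  - q4 * (y1 * v1 + y2 * v2 + y3 * v3))); first by field.
rewrite c1 c2 c3.
(* Once the accelerations are replaced, only multiples of the tangency equation and of the equation
   of the hyperboloid are left. *)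
transitivity (h * (D * q4 * (q1 * v1 + q2 * v2 + q3 * v3 - q4 * v4)
  - v4 * D * (q1 * q1 + q2 * q2 + q3 * q3 - q4 * q4 + 1))); first by rewrite /D; field.
by rewrite hv hq addNr !mulr0 subrr mulr0.
Qed.

Section Motion.
Variables (U V : 'rV[R]_4 -> R) (S : set 'rV[R]_4).
Hypothesis dualUV : forall x, ~ S (chart x) -> dual_potentials a U V x.
Variables (s0 s1 : R) (c : R -> 'rV[R]_4).
Hypothesis motion_c : is_motion U S s0 s1 c.

Let motion_tangent t : s0 < t < s1 -> mink (c t) (derive1 c t) = 0.
Proof.
move=> ht; apply: (@velocity_tangent c s0 s1) => //.
  by move=> y /motion_c [[]].
by case: (motion_c ht).
Qed.

Lemma gradient_dot3 q G u : is_diff (proj3 q) (U \o chart) (dot3 u) ->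
  is_gradient U q G -> forall w : 'rV[R]_3, mink G (dchart (proj3 q) w) = dot3 u w.
Proof. by move=> hu [_ hG] w; have := hG w; rewrite diff_chartE diff_val. Qed.

Let motion_at t : s0 < t < s1 -> exists u y : 'rV[R]_3,
  [/\ is_diff t (fun s => U (chart (proj3 (c s)))) (fun h => h * dot3 u (proj3 (derive1 c t))),
      is_diff t (fun s => V (chart (proj3 (c s)))) (fun h => h * dot3 y (proj3 (derive1 c t))),
      forall w : 'rV[R]_3, mink (cov_acc c t) (dchart (proj3 (c t)) w) = dot3 u w,
      [/\ rad (proj3 (c t)) ^+ 2 * ch1 u
            = (1 - a ^+ 2) * (ch1 y + dot3 (proj3 (c t)) y * co1 (c t)),
          rad (proj3 (c t)) ^+ 2 * ch2 u = ch2 y + dot3 (proj3 (c t)) y * co2 (c t)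
        & rad (proj3 (c t)) ^+ 2 * ch3 u = ch3 y + dot3 (proj3 (c t)) y * co3 (c t)]
    & co3 (c t) * ch2 u = co2 (c t) * ch3 u].
Proof.
move=> ht; have [[hc nS] dc ddc hG] := motion_c ht.
have nS' : ~ S (chart (proj3 (c t))) by rewrite chartK.
have [u [y [hu hv]]] := dualUV nS'; rewrite !ch_proj3 => e ru _.
exists u, y; split => //.
- apply: is_diff_ext (is_diff_comp (is_diff_proj3 dc) hu) _ _ => h //=.
  by rewrite /dot3 !chZ; ring.
- apply: is_diff_ext (is_diff_comp (is_diff_proj3 dc) hv) _ _ => h //=.
  by rewrite /dot3 !chZ; ring.
- exact: gradient_dot3 hu hG.
Qed.

Lemma mechanical_energy_constant t t' : s0 < t < s1 -> s0 < t' < s1 ->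
  mechanical_energy U (c t) (derive1 c t) = mechanical_energy U (c t') (derive1 c t').
Proof.
apply: (@constant_on_interval s0 s1 (fun t => mechanical_energy U (c t) (derive1 c t))
  (fun t => mink (derive1 c t) (derive1 c t) / 2 - U (chart (proj3 (c t))))) => {}t ht.
  have [[hc _] _ _ _] := motion_c ht.
  rewrite /mechanical_energy /normH sqr_sqrtr ?chartK //.
  by apply: mink_tangent_ge0 hc _; exact: motion_tangent.
have [[hc _] dc ddc _] := motion_c ht.
have [u [y [hu _ hG _ _]]] := motion_at ht.
have [h1 h2 h3 h4] := is_diff_co ddc.
(* The gradient is tested on the velocity itself, which yields the power of the force; the normal
   part of [cov_acc] does not contribute because the velocity is tangent. *)
have := hG (proj3 (derive1 c t)).
have hv := motion_tangent ht.
rewrite -tangent_dchart // => hGv.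
have hm := is_diff_add (is_diff_mul (is_diff_add (is_diff_add (is_diff_add
  (is_diff_mul h1 h1) (is_diff_mul h2 h2))
  (is_diff_mul h3 h3)) (is_diff_opp (is_diff_mul h4 h4))) (is_diff_const (2^-1) t))
  (is_diff_opp hu).
apply: is_diff_ext hm _ _ => h //.
have {hGv} : mink (derive1 (derive1 c) t) (derive1 c t) = dot3 u (proj3 (derive1 c t)).
  by rewrite -hGv /cov_acc minkDl minkZl hv mulr0 addr0.
move=> <-; rewrite /mink.
move: (co1 _) (co2 _) (co3 _) (co4 _) => A1 A2 A3 A4.
move: (co1 _) (co2 _) (co3 _) (co4 _) => v1 v2 v3 v4.
by field.
Qed.

Lemma projective_energy_constant t t' : s0 < t < s1 -> s0 < t' < s1 ->
  projective_energy a V (c t) (derive1 c t)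
  = projective_energy a V (c t') (derive1 c t').
Proof.
apply: (@constant_on_interval s0 s1
  (fun t => projective_energy a V (c t) (derive1 c t))
  (fun t => (co4 (c t) * co1 (derive1 c t) - co1 (c t) * co4 (derive1 c t)) ^+ 2
      / (2 * (1 - a ^+ 2))
    + (co4 (c t) * co2 (derive1 c t) - co2 (c t) * co4 (derive1 c t)) ^+ 2 / 2
    + (co4 (c t) * co3 (derive1 c t) - co3 (c t) * co4 (derive1 c t)) ^+ 2 / 2
    - V (chart (proj3 (c t))))) => {}t ht.
  have [[hc _] _ _ _] := motion_c ht.
  by rewrite /projective_energy chartK.
have [[hc _] dc ddc _] := motion_c ht.
have [u [y [_ hV hG [e1 e2 e3] _]]] := motion_at ht.
have [p1 p2 p3 p4] := is_diff_co dc.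
have [h1 h2 h3 h4] := is_diff_co ddc.
have hv := motion_tangent ht.
have q4 : co4 (c t) = - rad (proj3 (c t)) by rewrite -{1}(chartK hc) chartE co_vec4.
have q4N0 : co4 (c t) != 0 by rewrite q4 oppr_eq0 rad_neq0.
have r2 : rad (proj3 (c t)) ^+ 2 = co4 (c t) ^+ 2 by rewrite q4 sqrrN.
(* Lifts of chart vectors are tangent, so the covariant acceleration may be replaced by the ordinary
   one. *)
have acc k1 k2 k3 : mink (derive1 (derive1 c) t) (dchart (proj3 (c t)) (vec3 k1 k2 k3))
    = dot3 u (vec3 k1 k2 k3).
  rewrite -hG /cov_acc minkDl minkZl.
  rewrite (_ : mink (c t) (dchart _ _) = 0) ?mulr0 ?addr0 //.
  rewrite /mink /dchart !co_vec4 q4 mulrNN mulrCA mulfV ?rad_neq0 //.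
  by rewrite /dot3 !ch_proj3; ring.
have b1 := is_diff_sqr (is_diff_add (is_diff_mul p4 h1) (is_diff_opp (is_diff_mul p1 h4))).
have b2 := is_diff_sqr (is_diff_add (is_diff_mul p4 h2) (is_diff_opp (is_diff_mul p2 h4))).
have b3 := is_diff_sqr (is_diff_add (is_diff_mul p4 h3) (is_diff_opp (is_diff_mul p3 h4))).
have hm := is_diff_add (is_diff_add (is_diff_add
  (is_diff_mul b1 (is_diff_const (2 * (1 - a ^+ 2))^-1 t))
  (is_diff_mul b2 (is_diff_const (2^-1) t)))
  (is_diff_mul b3 (is_diff_const (2^-1) t)))
  (is_diff_opp hV).
(* The lift of [q4 e_i] has fourth coordinate [q_i], so these tests produce [A_i q4 - A4 q_i], the
   derivatives occurring in the projected system. *)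
have a1 := acc (co4 (c t)) 0 0; have a2 := acc 0 (co4 (c t)) 0.
have a3 := acc 0 0 (co4 (c t)).
apply: is_diff_ext hm _ _ => h //.
have cancel k : - (k * co4 (c t) / rad (proj3 (c t))) = k.
  by rewrite q4 mulrN mulNr opprK mulfK // rad_neq0.
move: a1 a2 a3 hv (hc.1) e1 e2 e3.
rewrite /dchart /mink !co_vec4 /dot3 ?ch_proj3 !ch_vec3 !(mulr0, addr0, add0r) !cancel r2.
have sN0 : 1 - a ^+ 2 != 0 by rewrite gt_eqF.
move=> k1 k2 k3 k4 k5 k6 k7 k8.
exact (projective_power h q4N0 sN0 k1 k2 k3 k4 k5 k6 k7 k8).
Qed.

Lemma L_yz_constant t t' : s0 < t < s1 -> s0 < t' < s1 ->
  L_yz (c t) (derive1 c t) = L_yz (c t') (derive1 c t').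
Proof.
apply: (@constant_on_interval s0 s1 (fun t => L_yz (c t) (derive1 c t))
  (fun t => L_yz (c t) (derive1 c t))) => // {}t ht.
have [[hc _] dc ddc _] := motion_c ht.
have [u [_ [_ _ hG _ ru]]] := motion_at ht.
have [_ p2 p3 _] := is_diff_co dc.
have [_ h2 h3 _] := is_diff_co ddc.
have hm := is_diff_add (is_diff_mul p3 h2) (is_diff_opp (is_diff_mul p2 h3)).
apply: is_diff_ext hm _ _ => h //.
have acc : co2 (derive1 (derive1 c) t) * co3 (c t)
    - co3 (derive1 (derive1 c) t) * co2 (c t) = 0.
  (* The test vector is the generator of the rotations about the first axis: it yields the torque,
     which vanishes by axial symmetry. *)
  have := hG (vec3 0 (co3 (c t)) (- co2 (c t))).
  rewrite [RHS](_ : _ = co3 (c t) * ch2 u - co2 (c t) * ch3 u); last first.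
    by rewrite /dot3 !ch_vec3; ring.
  rewrite ru subrr => <-.
  rewrite /cov_acc minkDl minkZl /mink /dchart !co_vec4 /dot3 ?ch_proj3 !ch_vec3.
  by ring.
transitivity (h * (co2 (derive1 (derive1 c) t) * co3 (c t)
    - co3 (derive1 (derive1 c) t) * co2 (c t))); last by rewrite acc mulr0.
by ring.
Qed.
End Motion.

Lemma first_integral_dual U V (S : set 'rV[R]_4) (i : 'I_3) :
  (forall x, ~ S (chart x) -> dual_potentials a U V x) ->
  first_integral U S
    (nth (@L_yz R) [:: mechanical_energy U; projective_energy a V; @L_yz R] i).
Proof.
move=> dualUV s0 s1 c hc t t' ht ht'; move: i; apply: ord3_ind => /=.
- apply: mechanical_energy_constant ht ht'; eassumption.
- apply: projective_energy_constant ht ht'; eassumption.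
- apply: L_yz_constant ht ht'; eassumption.
Qed.
End FirstIntegrals.

(** * Duality for the Kepler and Hooke potentials *)

Section Potentials.
Context {R : realType}.
Implicit Types (x : 'rV[R]_3) (q v w : 'rV[R]_4).

Lemma sqr_sub1_ge0 (u : R) : 1 <= u -> 0 <= u ^+ 2 - 1.
Proof. by move=> u1; rewrite subr_ge0 exprn_ege1. Qed.

(** The two numbers [u + sqrt (u^2 - 1)] and [u - sqrt (u^2 - 1)] are inverse to each other. *)
Lemma expR_arcosh (u : R) : 1 <= u ->
  expR (arcosh u) = u + Num.sqrt (u ^+ 2 - 1) /\
  expR (- arcosh u) = u - Num.sqrt (u ^+ 2 - 1).
Proof.
move=> u1; have y0 : 0 < u + Num.sqrt (u ^+ 2 - 1).
  by rewrite ltr_wpDr ?sqrtr_ge0 // (lt_le_trans ltr01).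
rewrite expRN /arcosh lnK //; split => //.
apply: (mulfI (lt0r_neq0 y0)); rewrite mulfV ?gt_eqF // mulrC -subr_sqr.
by rewrite sqr_sqrtr ?sqr_sub1_ge0 //; ring.
Qed.

Lemma cosh_arcosh (u : R) : 1 <= u -> cosh (arcosh u) = u.
Proof. by move=> /expR_arcosh[e1 e2]; rewrite /cosh e1 e2; field. Qed.

Lemma sinh_arcosh (u : R) : 1 <= u -> sinh (arcosh u) = Num.sqrt (u ^+ 2 - 1).
Proof. by move=> /expR_arcosh[e1 e2]; rewrite /sinh e1 e2; field. Qed.

Section Kepler.
Variable b : R.
Hypothesis b2_lt1 : 0 < 1 - b ^+ 2.
Let s := Num.sqrt (1 - b ^+ 2).

Let s_gt0 : 0 < s. Proof. by rewrite sqrtr_gt0. Qed.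
Let s_sqr : s ^+ 2 = 1 - b ^+ 2. Proof. by rewrite sqr_sqrtr // ltW. Qed.

(** Hyperbolic cosine of the distance to [Z1 b]. Taking [b = a] and [b = - a] treats both centers at
    once, by [Z1N]. *)
Definition coshZ x : R := (rad x - b * ch1 x) / s.

Lemma mink_Z1 x : - mink (chart x) (Z1 b) = coshZ x.
Proof. by rewrite /mink /Z1 chartE !co_vec4 -/s /coshZ; field; rewrite gt_eqF. Qed.

(** Multiplying [s^2] by [1 = r^2 - |x|^2] makes the expression a quadratic form in [x] and [r],
    which is a sum of squares. This gives both [coshZ x >= 1] and the equality case. *)
Lemma coshZ_sqr x : s ^+ 2 * (coshZ x ^+ 2 - 1) =
  (ch1 x - b * rad x) ^+ 2 + s ^+ 2 * (ch2 x ^+ 2 + ch3 x ^+ 2).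
Proof.
have -> : s ^+ 2 * (coshZ x ^+ 2 - 1) = (rad x - b * ch1 x) ^+ 2 - s ^+ 2.
  by rewrite /coshZ; field; rewrite gt_eqF.
rewrite s_sqr -[X in _ - X]mulr1.
rewrite -[X in _ - (_ * X)](_ : rad x ^+ 2 - ch1 x ^+ 2 - ch2 x ^+ 2 - ch3 x ^+ 2 = 1).
  by ring.
by rewrite rad_sqr; ring.
Qed.

Lemma coshZ_ge1 x : 1 <= coshZ x.
Proof.
have u0 : 0 < coshZ x.
  rewrite divr_gt0 // subr_gt0; have := rad_gt0 x; have := rad_sqr x.
  move=> e r0; rewrite ltNge; apply/negP => h.
  have : rad x ^+ 2 <= (b * ch1 x) ^+ 2 by rewrite lerXn2r // nnegrE ltW // (lt_le_trans r0).
  rewrite e exprMn.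
  have := sqr_ge0 (ch1 x); have := sqr_ge0 (ch2 x); have := sqr_ge0 (ch3 x).
  have := mulr_ge0 (ltW b2_lt1) (sqr_ge0 (ch1 x)).
  by rewrite mulrBl mul1r; lra.
have := coshZ_sqr x.
have : 0 <= (ch1 x - b * rad x) ^+ 2 + s ^+ 2 * (ch2 x ^+ 2 + ch3 x ^+ 2).
  exact (addr_ge0 (sqr_ge0 _) (mulr_ge0 (sqr_ge0 _) (addr_ge0 (sqr_ge0 _) (sqr_ge0 _)))).
move=> h e; rewrite -(@ler_pXn2r _ 2) ?nnegrE ?ler01 ?(ltW u0) // expr1n.
by move: h; rewrite -e pmulr_rge0 ?exprn_gt0 // subr_ge0.
Qed.

Lemma coshZ_gt1 x : chart x != Z1 b -> 0 < coshZ x ^+ 2 - 1.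
Proof.
move=> xZ; rewrite lt_neqAle sqr_sub1_ge0 ?coshZ_ge1 // andbT eq_sym.
apply: contraNneq xZ => h.
have := coshZ_sqr x; rewrite h mulr0 => /esym/eqP.
rewrite (paddr_eq0 (sqr_ge0 _) (mulr_ge0 (sqr_ge0 _) (addr_ge0 (sqr_ge0 _) (sqr_ge0 _)))).
rewrite sqrf_eq0 subr_eq0 => /andP[/eqP e1].
rewrite mulf_eq0 sqrf_eq0 (gt_eqF s_gt0) /= paddr_eq0 ?sqr_ge0 // !sqrf_eq0.
move=> /andP[/eqP e2 /eqP e3].
(* All squares vanish, so [x = (b r, 0, 0)] and [r^2 = 1 + b^2 r^2], which determines [r]. *)
have er : rad x = s^-1.
  have rs : rad x * s = 1.
    apply/eqP; rewrite -(@eqrXn2 _ 2) ?mulr_ge0 ?ltW ?rad_gt0 ?ltr01 // expr1n exprMn s_sqr.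
    by have := rad_sqr x; rewrite e1 e2 e3 => k; apply/eqP; lra.
  by rewrite -[LHS](mulfK (lt0r_neq0 s_gt0)) rs mul1r.
by rewrite chartE e1 e2 e3 er /Z1 -/s mul1r.
Qed.

Lemma coth_theta_chart x :
  coth (theta (Z1 b) (chart x)) = coshZ x / Num.sqrt (coshZ x ^+ 2 - 1).
Proof.
by rewrite /coth /theta mink_Z1 cosh_arcosh ?sinh_arcosh ?coshZ_ge1.
Qed.

Definition kepler_dual q : R :=
  (Num.sqrt ((- co1 q / co4 q - b) ^+ 2 / (1 - b ^+ 2)
             + (co2 q ^+ 2 + co3 q ^+ 2) / co4 q ^+ 2))^-1.

(** The radicand is [sinh^2 / r^2] by [coshZ_sqr], with [sinh] taken at the distance to the
    center. *)
Lemma kepler_dual_chart x :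
  kepler_dual (chart x) = rad x / Num.sqrt (coshZ x ^+ 2 - 1).
Proof.
have r0 := rad_gt0 x.
have e : (- ch1 x / - rad x - b) ^+ 2 / (1 - b ^+ 2)
    + (ch2 x ^+ 2 + ch3 x ^+ 2) / (- rad x) ^+ 2 = (coshZ x ^+ 2 - 1) * (rad x)^-1 ^+ 2.
  apply: (mulfI (_ : s ^+ 2 != 0)); first by rewrite expf_neq0 // gt_eqF.
  rewrite mulrA coshZ_sqr -s_sqr.
  by field; rewrite ?oppr_eq0 !gt_eqF.
rewrite /kepler_dual chartE !co_vec4 e.
rewrite sqrtrM ?sqr_sub1_ge0 ?coshZ_ge1 // sqrtr_sqr ger0_norm ?invr_ge0 ?ltW //.
by rewrite invfM invrK mulrC.
Qed.

Lemma is_diff_coshZ x :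
  is_diff x coshZ (dot3 (s^-1 *: ((rad x)^-1 *: x - vec3 b 0 0))).
Proof.
have h := is_diff_mul (is_diff_add (is_diff_rad x)
  (is_diff_opp (is_diff_mul (is_diff_const b x) (is_diff_ch1 x))))
  (is_diff_const s^-1 x).
apply: is_diff_ext h _ _ => // w.
rewrite /dot3 !(chZ, chD, chN, ch_vec3).
by field; rewrite rad_neq0 gt_eqF.
Qed.

Lemma dual_potentials_kepler x : chart x != Z1 b ->
  dual_potentials b (fun q => coth (theta (Z1 b) q))
    (fun q => s^-1 * kepler_dual q) x.
Proof.
move=> xZ; have N0 := coshZ_gt1 xZ.
set u := coshZ x in N0 *; set sg := Num.sqrt (u ^+ 2 - 1).
have sg0 : 0 < sg by rewrite sqrtr_gt0.
have sg2 : sg ^+ 2 = u ^+ 2 - 1 by rewrite sqr_sqrtr // ltW.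
have r0 := rad_gt0 x.
have h1 := is_diff_coshZ x.
have hs := is_diff_inv (is_diff_sqrt
  (is_diff_add (is_diff_sqr h1) (is_diff_const (-1) x)) N0) (lt0r_neq0 sg0).
have hr := is_diff_rad x.
pose du := s^-1 *: ((rad x)^-1 *: x - vec3 b 0 0).
(* The witnesses are the gradients of [u / sg] and of [r / (s sg)], where [du] is the gradient of
   [u] and [sg^2 = u^2 - 1]. *)
exists (- (sg ^+ 3)^-1 *: du).
exists ((sg ^+ 3 * s)^-1 *: (((u ^+ 2 - 1) / rad x) *: x - (rad x * u) *: du)).
split.
- apply: is_diff_ext (is_diff_mul h1 hs) _ _ => w /=; first by rewrite coth_theta_chart.
  transitivity (dot3 du w * (sg ^+ 2 - u ^+ 2) / sg ^+ 3).
    by rewrite -/u -/sg -/du; field; rewrite gt_eqF.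
  rewrite sg2 (_ : u ^+ 2 - 1 - u ^+ 2 = -1); last by ring.
  by rewrite /dot3 !(chZ _ du); ring.
- have hV := is_diff_mul (is_diff_const s^-1 x) (is_diff_mul hr hs).
  apply: is_diff_ext hV _ _ => w /=; first by rewrite kepler_dual_chart.
  rewrite -/u -/sg -/du -sg2 /dot3 !(chZ, chD, chN).
  by field; rewrite !gt_eqF.
- have dE : [/\ ch1 du = s^-1 * ((rad x)^-1 * ch1 x - b), ch2 du = s^-1 * ((rad x)^-1 * ch2 x)
    & ch3 du = s^-1 * ((rad x)^-1 * ch3 x)].
    by rewrite /du !(chZ, chD, chN, ch_vec3) !subr0.
  have xx : ch1 x * ch1 x + ch2 x * ch2 x + ch3 x * ch3 x = rad x ^+ 2 - 1.
    by rewrite rad_sqr; ring.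
  have hd : dot3 x du = u - (rad x * s)^-1.
    case: dE => d1 d2 d3; rewrite /dot3 d1 d2 d3.
    transitivity (s^-1 * ((rad x)^-1 * (ch1 x * ch1 x + ch2 x * ch2 x + ch3 x * ch3 x)
      - b * ch1 x)); first by ring.
    by rewrite xx /u /coshZ; field; rewrite !gt_eqF.
  have hy : dot3 x ((sg ^+ 3 * s)^-1 *: (((u ^+ 2 - 1) / rad x) *: x - (rad x * u) *: du))
    = (sg ^+ 3 * s)^-1 * ((u ^+ 2 - 1) / rad x * (rad x ^+ 2 - 1)
       - rad x * u * (u - (rad x * s)^-1)).
    by rewrite -hd -xx /dot3 !(chD, chN, chZ _ (_ - _), chZ _ x, chZ _ du); ring.
  case: dE => d1 d2 d3.
  split; rewrite hy !(chD, chN, chZ, ch_vec3) ?subr0.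
  + rewrite -s_sqr.
    transitivity ((sg ^+ 3)^-1 * (- rad x * ch1 x / s + rad x ^+ 2 * b / s)).
      by field; rewrite !gt_eqF.
    (* [field] treats [s] and [b] as independent; this intermediate form isolates the one use of
       [b^2 = 1 - s^2]. *)
    transitivity ((sg ^+ 3)^-1 * (- s * rad x * ch1 x + rad x ^+ 2 * b / s
      - b ^+ 2 * ch1 x * rad x / s)).
      have -> : b ^+ 2 = 1 - s ^+ 2 by rewrite s_sqr; ring.
      by field; rewrite !gt_eqF.
    by rewrite /u /coshZ; field; rewrite !gt_eqF.
  + by field; rewrite !gt_eqF.
  + by field; rewrite !gt_eqF.
- by rewrite !(chZ, chD, chN, ch_vec3); ring.
- by rewrite !(chZ, chD, chN, ch_vec3); ring.
Qed.
End Kepler.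

Section Lagrange.
Variable a : R.
Hypothesis a2_lt1 : 0 < 1 - a ^+ 2.
Let s := Num.sqrt (1 - a ^+ 2).

Definition hooke_dual q : R :=
  co1 q ^+ 2 / (co4 q ^+ 2 * (1 - a ^+ 2)) + (co2 q ^+ 2 + co3 q ^+ 2) / co4 q ^+ 2.

Lemma rad_ge1 x : 1 <= rad x.
Proof.
rewrite -(@ler_pXn2r _ 2) ?nnegrE ?ler01 ?(ltW (rad_gt0 x)) // expr1n rad_sqr.
by rewrite -!addrA lerDl !addr_ge0 ?sqr_ge0.
Qed.

Lemma tanh_theta_Hooke x :
  tanh (theta ZHooke (chart x)) ^+ 2 = 1 - (rad x ^+ 2)^-1.
Proof.
have -> : theta ZHooke (chart x) = arcosh (rad x).
  by rewrite /theta /mink /ZHooke chartE !co_vec4; congr arcosh; ring.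
rewrite /tanh sinh_arcosh ?cosh_arcosh ?rad_ge1 // expr_div_n sqr_sqrtr.
  by field; rewrite rad_neq0.
by rewrite sqr_sub1_ge0 ?rad_ge1.
Qed.

Lemma dual_potentials_hooke x :
  dual_potentials a (fun q => tanh (theta ZHooke q) ^+ 2) hooke_dual x.
Proof.
have r0 := rad_neq0 x; have aN0 : 1 - a ^+ 2 != 0 by rewrite gt_eqF.
(* In the chart the two potentials are [1 - 1 / r^2] and [K / r^2], and the witnesses below are
   their gradients. *)
pose K := ch1 x ^+ 2 / (1 - a ^+ 2) + ch2 x ^+ 2 + ch3 x ^+ 2.
have hr2 := is_diff_inv (is_diff_sqr (is_diff_rad x)) (expf_neq0 2 r0).
exists ((2 / rad x ^+ 4) *: x).
exists ((2 / rad x ^+ 2) *: vec3 (ch1 x / (1 - a ^+ 2)) (ch2 x) (ch3 x)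
        - (2 * K / rad x ^+ 4) *: x).
split.
- apply: is_diff_ext (is_diff_add (is_diff_const 1 x) (is_diff_opp hr2)) _ _ => w /=.
    by rewrite tanh_theta_Hooke.
  by rewrite /dot3 !(chZ, chD, chN, ch_vec3); field.
- have hK := is_diff_add (is_diff_add
    (is_diff_mul (is_diff_sqr (is_diff_ch1 x)) (is_diff_const (1 - a ^+ 2)^-1 x))
    (is_diff_sqr (is_diff_ch2 x))) (is_diff_sqr (is_diff_ch3 x)).
  apply: is_diff_ext (is_diff_mul hK hr2) _ _ => w /=.
    by rewrite /hooke_dual chartE !co_vec4 sqrrN; field; rewrite rad_neq0.
  by rewrite /dot3 !(chZ, chD, chN, ch_vec3) /K; field; rewrite r0.
(* By Euler's identity for the quadratic form [K], [x . y = 2 K / r^2 - 2 K |x|^2 / r^4], and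
   [|x|^2 = r^2 - 1]. *)
- have hy : dot3 x ((2 / rad x ^+ 2) *: vec3 (ch1 x / (1 - a ^+ 2)) (ch2 x) (ch3 x)
      - (2 * K / rad x ^+ 4) *: x) = 2 * K / rad x ^+ 4.
    transitivity (2 * K / rad x ^+ 2 - 2 * K / rad x ^+ 4 * (rad x ^+ 2 - 1)).
      by rewrite rad_sqr /dot3 !(chZ, chD, chN, ch_vec3) /K; ring.
    by field.
  split; rewrite hy !(chZ, chD, chN, ch_vec3); field; by rewrite ?aN0 r0.
- by rewrite !(chZ, chD, chN, ch_vec3); ring.
- by rewrite !(chZ, chD, chN, ch_vec3); ring.
Qed.

Definition lagrange_dual (mh1 mh2 f : R) q : R :=
  mh1 * (s^-1 * kepler_dual a q) + mh2 * (s^-1 * kepler_dual (- a) q)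
  + f * hooke_dual q.

Lemma Z1N : Z1 (- a) = Z2 a.
Proof. by rewrite /Z1 /Z2 sqrrN mulNr. Qed.

Lemma dual_potentialsN U V x : dual_potentials (- a) U V x -> dual_potentials a U V x.
Proof. by rewrite /dual_potentials sqrrN. Qed.

Lemma dual_potentials_lagrange mh1 mh2 f x : ~ lagrange_sing a mh1 mh2 (chart x) ->
  dual_potentials a (lagrange_force a mh1 mh2 f) (lagrange_dual mh1 mh2 f) x.
Proof.
move=> nS; apply: dual_potentialsD; first apply: dual_potentialsD.
- have [->|m0] := eqVneq mh1 0.
    by apply: dual_potentials_null.
  apply: dual_potentialsZ; apply: dual_potentials_kepler => //.
  by apply/eqP => xZ; apply: nS; left.
- have [->|m0] := eqVneq mh2 0.
    by apply: dual_potentials_null.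
  apply: dual_potentialsN; rewrite /kepler_force -Z1N.
  have -> : s = Num.sqrt (1 - (- a) ^+ 2) by rewrite sqrrN.
  apply: dual_potentialsZ; apply: dual_potentials_kepler; first by rewrite sqrrN.
  by apply/eqP => xZ; apply: nS; right; split => //; rewrite -Z1N.
- exact: (dual_potentialsZ _ (dual_potentials_hooke x)).
Qed.

Lemma E_hyp_mechanical mh1 mh2 f :
  E_hyp a mh1 mh2 f = mechanical_energy (lagrange_force a mh1 mh2 f).
Proof.
apply/funext => q; apply/funext => v.
rewrite /E_hyp /mechanical_energy /lagrange_force /kepler_force /hooke_force /tanh /coth.
by rewrite !invf_div !opprD !addrA.
Qed.

Lemma E_sp_projective mh1 mh2 f :
  E_sp a mh1 mh2 f = projective_energy a (lagrange_dual mh1 mh2 f).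
Proof.
apply/funext => q; apply/funext => v.
rewrite /E_sp /projective_energy /lagrange_dual /kepler_dual sqrrN opprK -/s.
by rewrite /hooke_dual; ring.
Qed.

Lemma lagrange_integralsE mh1 mh2 f (i : 'I_3) : lagrange_integrals a mh1 mh2 f i =
  nth (@L_yz R) [:: mechanical_energy (lagrange_force a mh1 mh2 f);
    projective_energy a (lagrange_dual mh1 mh2 f); @L_yz R] i.
Proof. by rewrite /lagrange_integrals E_hyp_mechanical E_sp_projective. Qed.

End Lagrange.
End Potentials.

(** * Functional independence on a dense open set *)

Section Independence.
Context {R : realType}.

Lemma near_not_root (p : {poly R}) (B : set R) : p != 0 -> nbhs (0 : R) B ->
  exists2 e, B e & p.[e] != 0.
Proof.
move=> p0 /nbhs_ballP[d /= d0 dB]; apply: contrapT => h.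
(* These are [size p] distinct points of the ball of radius [d], more than the possible roots; the
   shift by 2 keeps even the first one strictly inside. *)
pose rs := [seq d / k.+2%:R | k <- iota 0 (size p)].
have rs_root : all (root p) rs.
  apply/allP => _ /mapP[k _ ->]; apply/rootP; apply: contrapT => /eqP kN0; apply: h.
  exists (d / k.+2%:R) => //; apply: dB.
  rewrite /ball /= sub0r normrN gtr0_norm ?divr_gt0 ?ltr0n //.
  by rewrite ltr_pdivrMr ?ltr0n // ltr_pMr // ltr1n.
have rs_uniq : uniq rs.
  rewrite map_inj_uniq ?iota_uniq // => k l /(mulfI (lt0r_neq0 d0)) /invr_inj /eqP.
  by rewrite eqr_nat => /eqP [].
by have := max_poly_roots p0 rs_root rs_uniq; rewrite size_map size_iota ltnn.
Qed.

Lemma cramer3 (k0 k1 k2 a1 a2 a3 b1 b2 b3 c1 c2 c3 : R) :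
  k0 * a1 + k1 * b1 + k2 * c1 = 0 -> k0 * a2 + k1 * b2 + k2 * c2 = 0 ->
  k0 * a3 + k1 * b3 + k2 * c3 = 0 ->
  a1 * (b2 * c3 - b3 * c2) - b1 * (a2 * c3 - a3 * c2) + c1 * (a2 * b3 - a3 * b2) != 0 ->
  [/\ k0 = 0, k1 = 0 & k2 = 0].
Proof.
move=> e1 e2 e3; set D := (X in X != 0) => D0.
suff [h0 h1 h2] : [/\ k0 * D = 0, k1 * D = 0 & k2 * D = 0].
  by split; apply: (mulIf D0); rewrite mul0r.
split.
- transitivity ((k0 * a1 + k1 * b1 + k2 * c1) * (b2 * c3 - b3 * c2)
    - (k0 * a2 + k1 * b2 + k2 * c2) * (b1 * c3 - b3 * c1)
    + (k0 * a3 + k1 * b3 + k2 * c3) * (b1 * c2 - b2 * c1)); first by rewrite /D; ring.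
  by rewrite e1 e2 e3; ring.
- transitivity (- (k0 * a1 + k1 * b1 + k2 * c1) * (a2 * c3 - a3 * c2)
    + (k0 * a2 + k1 * b2 + k2 * c2) * (a1 * c3 - a3 * c1)
    - (k0 * a3 + k1 * b3 + k2 * c3) * (a1 * c2 - a2 * c1)); first by rewrite /D; ring.
  by rewrite e1 e2 e3; ring.
- transitivity ((k0 * a1 + k1 * b1 + k2 * c1) * (a2 * b3 - a3 * b2)
    - (k0 * a2 + k1 * b2 + k2 * c2) * (a1 * b3 - a3 * b1)
    + (k0 * a3 + k1 * b3 + k2 * c3) * (a1 * b2 - a2 * b1)); first by rewrite /D; ring.
  by rewrite e1 e2 e3; ring.
Qed.

Variable a : R.
Hypothesis a2_lt1 : 0 < 1 - a ^+ 2.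
Let w1 : R := (1 - a ^+ 2)^-1.
Implicit Types (z : 'rV[R]_3 * 'rV[R]_3).

(* The determinant of the derivatives of the three integrals along the fibre,
   divided by [rad ^ 2]. *)
Definition fibre_det z : R :=
  let x1 := ch1 z.1 in let x2 := ch2 z.1 in let x3 := ch3 z.1 in
  let p1 := ch1 z.2 in let p2 := ch2 z.2 in let p3 := ch3 z.2 in
  let P := p2 * x2 + p3 * x3 in
  (w1 - 1) * (p1 * P) + (p1 * x1 + P) * (w1 * p1 * (x2 ^+ 2 + x3 ^+ 2) - x1 * P).

(** Every term contains [x2] or [x3]. Hence the set where the determinant is nonzero avoids the
    centers, which lie on the first axis. *)
Lemma fibre_det_off_axis z : fibre_det z != 0 -> ch2 z.1 ^+ 2 + ch3 z.1 ^+ 2 != 0.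
Proof.
apply: contraNneq => /eqP; rewrite paddr_eq0 ?sqr_ge0 // !sqrf_eq0.
by move=> /andP[/eqP e2 /eqP e3]; rewrite /fibre_det e2 e3; apply/eqP; ring.
Qed.

Lemma differentiable_fibre_det z : differentiable fibre_det z.
Proof.
have c1 := is_diff_fst_comp (is_diff_ch1 z.1).
have c2 := is_diff_fst_comp (is_diff_ch2 z.1).
have c3 := is_diff_fst_comp (is_diff_ch3 z.1).
have b1 := is_diff_snd_comp (is_diff_ch1 z.2).
have b2 := is_diff_snd_comp (is_diff_ch2 z.2).
have b3 := is_diff_snd_comp (is_diff_ch3 z.2).
have P := is_diff_add (is_diff_mul b2 c2) (is_diff_mul b3 c3).
have s := is_diff_add (is_diff_mul b1 c1) P.
have m := is_diff_add (is_diff_mul (is_diff_mul (is_diff_const w1 z) b1)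
  (is_diff_add (is_diff_sqr c2) (is_diff_sqr c3))) (is_diff_opp (is_diff_mul c1 P)).
by have [] := is_diff_add (is_diff_mul (is_diff_const (w1 - 1) z) (is_diff_mul b1 P))
  (is_diff_mul s m).
Qed.

Lemma open_fibre_det : open [set z | fibre_det z != 0].
Proof.
apply: (@open_comp _ _ fibre_det [set y | y != 0]); last exact: open_neq.
by move=> z _; exact/differentiable_continuous/differentiable_fibre_det.
Qed.

(** Expansion in [e] of the determinant along a fixed direction, with [s_i], [m_i], [n_i] the
    coefficients of [p.x], [p1 (p.x)] and [x1 P]. The direction makes the leading coefficient [w1],
    nonzero whatever the base point. *)
Definition fibre_det_poly z : {poly R} :=
  let x1 := ch1 z.1 in let x2 := ch2 z.1 in let x3 := ch3 z.1 in
  let p1 := ch1 z.2 in let p2 := ch2 z.2 in let p3 := ch3 z.2 in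
  let P0 := p2 * x2 + p3 * x3 in
  let s0 := p1 * x1 + P0 in let s1 := x1 + p1 + p2 in
  let r0 := x2 ^+ 2 + x3 ^+ 2 in
  let m0 := p1 * s0 in let m1 := s0 + p1 * s1 in let m2 := s1 + p1 in
  let n0 := x1 * P0 in let n1 := P0 + x1 * p2 in let n2 := p2 in
  Poly [:: w1 * r0 * m0 + (w1 - 1) * p1 * P0 - s0 * n0;
    w1 * (r0 * m1 + 2 * x2 * m0) + (w1 - 1) * (P0 + p1 * p2) - (s1 * n0 + s0 * n1);
    w1 * (r0 * m2 + 2 * x2 * m1 + m0) + (w1 - 1) * p2 - (n0 + s1 * n1 + s0 * n2);
    w1 * (r0 + 2 * x2 * m2 + m1) - (n1 + s1 * n2);
    w1 * (2 * x2 + m2) - n2;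
    w1].

Lemma fibre_det_polyE z e : (fibre_det_poly z).[e] =
  fibre_det (z + e *: (vec3 1 1 0, vec3 1 0 0)).
Proof.
rewrite /fibre_det /fibre_det_poly horner_Poly /= !(chD, chZ, ch_vec3).
by ring.
Qed.

Lemma fibre_det_poly_neq0 z : fibre_det_poly z != 0.
Proof.
apply/eqP => /(congr1 (fun p : {poly R} => p`_5)).
rewrite /fibre_det_poly coef_Poly coef0 /=.
by apply/eqP; rewrite invr_eq0 gt_eqF.
Qed.

Lemma dense_fibre_det z : closure [set z | fibre_det z != 0] z.
Proof.
move=> B zB.
pose g (e : R) := z + e *: ((vec3 1 1 0, vec3 1 0 0) : 'rV[R]_3 * 'rV[R]_3).
have gc : {for 0, continuous g}.
  apply: cvgD; first exact: cvg_cst.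
  exact: scalel_continuous.
have g0 : g 0 = z by rewrite /g scale0r addr0.
have := gc B; rewrite g0 => /(_ zB) nB.
have [e Be pe] := near_not_root (fibre_det_poly_neq0 z) nB.
by exists (g e); split => //=; rewrite -fibre_det_polyE.
Qed.

Lemma functionally_independent_dual U V (S : set 'rV[R]_4) :
  (forall x, ~ S (chart x) -> dual_potentials a U V x) ->
  (forall x, S (chart x) -> ch2 x ^+ 2 + ch3 x ^+ 2 = 0) ->
  functionally_independent S (fun i : 'I_3 =>
    nth (@L_yz R) [:: mechanical_energy U; projective_energy a V; @L_yz R] i).
Proof.
move=> dualUV S_axis; split.
  move=> i z zS; have [u [y [/is_diff_mechanical hu /(is_diff_projective a2_lt1) hv _ _ _]]] :=
    dualUV _ zS.
  move: i; apply: ord3_ind => /=; [by case: hu | by case: hv | by case: (is_diff_L z)].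
have sub : [set z | fibre_det z != 0] `<=` phase_space S.
  by move=> z /= /fibre_det_off_axis /eqP h /S_axis.
exists [set z | fibre_det z != 0]; split => //.
- exact: open_fibre_det.
- by move=> z _; exact: dense_fibre_det.
move=> z /= dz k hk.
have [u [y [/is_diff_mechanical hu /(is_diff_projective a2_lt1) hv _ _ _]]] :=
    dualUV _ (sub _ dz).
have hL := is_diff_L z.
have [_ eu] := hu; have [_ ev] := hv; have [_ eL] := hL.
(* On vertical vectors the potentials disappear from the linear relation, leaving a 3 by 3
   system. *)
have lin (p : 'rV[R]_3) :
    k (@Ordinal 3 0 isT) * (dot3 z.2 p + dot3 z.1 z.2 * dot3 z.1 p)
    + k (@Ordinal 3 1 isT) * (rad z.1 ^+ 2 * wt a z.2 p)
    + k (@Ordinal 3 2 isT) * (ch3 z.1 * ch2 p - ch2 z.1 * ch3 p) = 0.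
  rewrite -[RHS](hk (0, p)) sum_ord3 /= eu ev eL /= /dot3 !ch_zero.
  by rewrite !(mulr0, mul0r, addr0, add0r, subr0).
have := lin (basis3 (@Ordinal 3 0 isT)).
have := lin (basis3 (@Ordinal 3 1 isT)).
have := lin (basis3 (@Ordinal 3 2 isT)).
rewrite /dot3 /wt !ch_basis3.
rewrite !(mulr0, mul0r, mulr1, addr0, add0r, subr0, sub0r) => e3 e2 e1.
have [|h0 h1 h2] := cramer3 e1 e2 e3.
  rewrite (_ : _ + _ = rad z.1 ^+ 2 * fibre_det z); last by rewrite /fibre_det /w1; ring.
  by rewrite mulf_neq0 // expf_neq0 // rad_neq0.
exact: ord3_ind.
Qed.
End Independence.

(** * Addition formula and monotonicity of the hyperbolic cosine *)

Section Cosh.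
Context {R : realType}.
Implicit Types x y u : R.

Lemma coshD x y : cosh (x + y) = cosh x * cosh y + sinh x * sinh y.
Proof. by rewrite /cosh /sinh opprD !expRD; field. Qed.

Lemma coshN x : cosh (- x) = cosh x.
Proof. by rewrite /cosh opprK addrC. Qed.

Lemma sinhN x : sinh (- x) = - sinh x.
Proof. by rewrite /sinh opprK; field. Qed.

Lemma cosh_norm x : cosh `|x| = cosh x.
Proof. by case: (ger0P x) => // _; rewrite coshN. Qed.

Lemma cosh_lt x y : 0 <= x -> x < y -> cosh x < cosh y.
Proof.
move=> x0 xy; rewrite -subr_gt0.
have -> : cosh y - cosh x = (expR y - expR x) * (1 - expR (- (x + y))) / 2.
  rewrite /cosh opprD expRD !expRN; field.
  by rewrite !gt_eqF ?expR_gt0.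
rewrite divr_gt0 // mulr_gt0 ?subr_gt0 ?ltr_expR //.
rewrite -[ltRHS]expR0 ltr_expR oppr_lt0.
by rewrite ltr_wpDl // (le_lt_trans x0).
Qed.

Lemma cosh_inj x y : 0 <= x -> 0 <= y -> cosh x = cosh y -> x = y.
Proof.
move=> x0 y0 e; case: (ltgtP x y) => // [/(cosh_lt x0)|/(cosh_lt y0)];
  by rewrite e ltxx.
Qed.

Lemma arcosh_ge0 u : 1 <= u -> 0 <= arcosh u.
Proof. by move=> u1; rewrite ln_ge0 // (le_trans u1) // lerDl sqrtr_ge0. Qed.

End Cosh.

(** * Tangent vectors of quadratic cones cut with the hyperboloid *)

Section Cone.
Context {R : realType}.
Implicit Types (q v w : 'rV[R]_4) (B : set 'rV[R]_4).

(** The curve follows a straight line in the first three coordinates, is lifted to the cone by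
    solving for the fourth one ([g != 0]), and is rescaled to the hyperboloid, which keeps it in the
    homogeneous cone. *)
Lemma tangent_cone B (g k1 k2 : R) q w : g != 0 ->
  (forall y, hyp y ->
    g * co4 y ^+ 2 = k1 * co1 y ^+ 2 + k2 * (co2 y ^+ 2 + co3 y ^+ 2) -> B y) ->
  hyp q -> g * co4 q ^+ 2 = k1 * co1 q ^+ 2 + k2 * (co2 q ^+ 2 + co3 q ^+ 2) ->
  mink q w = 0 ->
  g * (co4 q * co4 w) = k1 * (co1 q * co1 w) + k2 * (co2 q * co2 w + co3 q * co3 w) ->
  tangent_at B q w.
Proof.
move=> g0 subB [hq q4] cq hw cw.
pose y1 (t : R) := co1 q + t * co1 w; pose y2 (t : R) := co2 q + t * co2 w.
pose y3 (t : R) := co3 q + t * co3 w.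
(* [N] is the square of the lifted fourth coordinate and [M] that of the scaling factor. The
   linearized cone equation gives [N' = 2 q4 w4] at 0 and tangency gives [M' = 0], so rescaling does
   not change the velocity. *)
pose N t := (k1 * y1 t ^+ 2 + k2 * (y2 t ^+ 2 + y3 t ^+ 2)) / g.
pose M t := N t - (y1 t ^+ 2 + y2 t ^+ 2 + y3 t ^+ 2).
have dline (b d : R) : is_diff (0 : R) (fun t : R => b + t * d) (fun h => h * d).
  apply: is_diff_ext (is_diff_add (is_diff_const b 0)
    (is_diff_mul (is_diff_id (0 : R)) (is_diff_const d 0))) _ _ => h //=.
  by ring.
have s1 := is_diff_sqr (dline (co1 q) (co1 w)).
have s2 := is_diff_sqr (dline (co2 q) (co2 w)).
have s3 := is_diff_sqr (dline (co3 q) (co3 w)).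
have dN : is_diff 0 N (fun h => h * (2 * (co4 q * co4 w))).
  apply: is_diff_ext (is_diff_mul (is_diff_add (is_diff_mul (is_diff_const k1 0) s1)
    (is_diff_mul (is_diff_const k2 0) (is_diff_add s2 s3))) (is_diff_const g^-1 0))
    _ _ => h //=.
  apply: (mulfI g0).
  transitivity (h * 2 * (g * (co4 q * co4 w))); last by ring.
  by rewrite cw; field.
have N0 : N 0 = co4 q ^+ 2.
  by rewrite /N /y1 /y2 /y3 !mul0r !addr0 -cq mulrC mulKf.
have dM : is_diff 0 M (fun=> 0).
  apply: is_diff_ext (is_diff_add dN (is_diff_opp (is_diff_add (is_diff_add s1 s2) s3)))
    _ _ => h //=.
  rewrite !mul0r !addr0; transitivity (- (2 * h) * mink q w); last by rewrite hw mulr0.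
  by rewrite /mink; ring.
have M0 : M 0 = 1.
  by rewrite /M N0 /y1 /y2 /y3 !mul0r !addr0; move: hq; rewrite /mink; lra.
have Npos : 0 < N 0 by rewrite N0 exprn_even_gt0 //= lt_eqF.
have Mpos : 0 < M 0 by rewrite M0.
have sN0 : Num.sqrt (N 0) = - co4 q by rewrite N0 sqrtr_sqr ltr0_norm.
have sM0 : Num.sqrt (M 0) = 1 by rewrite M0 sqrtr1.
have sMN0 : Num.sqrt (M 0) != 0 by rewrite sM0.
pose c t := vec4 (y1 t / Num.sqrt (M t)) (y2 t / Num.sqrt (M t))
  (y3 t / Num.sqrt (M t)) (- Num.sqrt (N t) / Num.sqrt (M t)).
exists c; split.
- rewrite /c sM0 sN0 !divr1 opprK /y1 /y2 /y3 !mul0r !addr0.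
  by rewrite -vec4_eta.
- have near_pos (f df : R -> R) : is_diff 0 f df -> 0 < f 0 -> \forall t \near (0 : R), 0 < f t.
    move=> [df0 _] f0; have := differentiable_continuous df0.
    by move/(_ [set y | 0 < y]); apply; exact: lt_nbhsr.
  near=> t.
  have Nt : 0 < N t by near: t; exact: near_pos dN Npos.
  have Mt : 0 < M t by near: t; exact: near_pos dM Mpos.
  have sM2 := sqr_sqrtr (ltW Mt); have sN2 := sqr_sqrtr (ltW Nt).
  have sMt : 0 < Num.sqrt (M t) by rewrite sqrtr_gt0.
  have sNt : 0 < Num.sqrt (N t) by rewrite sqrtr_gt0.
  apply: subB.
    split; last by rewrite /c co_vec4 mulNr oppr_lt0 divr_gt0.
    rewrite /mink /c !co_vec4.
    transitivity ((y1 t ^+ 2 + y2 t ^+ 2 + y3 t ^+ 2 - Num.sqrt (N t) ^+ 2)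
      / Num.sqrt (M t) ^+ 2); first by field; rewrite gt_eqF.
    by rewrite sN2 sM2 (_ : _ - N t = - M t) ?mulNr ?mulfV ?gt_eqF // /M; ring.
  rewrite /c !co_vec4 !exprMn sqrrN sN2 /N.
  set z := (Num.sqrt _)^-1; move: (y1 t) (y2 t) (y3 t) z => z1 z2 z3 z.
  by field.
- have dis := is_diff_inv (is_diff_sqrt dM Mpos) sMN0.
  have dc := is_diff_vec4 (is_diff_mul (dline (co1 q) (co1 w)) dis)
    (is_diff_mul (dline (co2 q) (co2 w)) dis) (is_diff_mul (dline (co3 q) (co3 w)) dis)
    (is_diff_mul (is_diff_opp (is_diff_sqrt dN Npos)) dis).
  have := is_derive_of_is_diff dc.
  rewrite sM0 sN0 => h; apply: is_derive_eq h _; rewrite [RHS]vec4_eta.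
  by congr vec4; field; rewrite ?lt_eqF.
Unshelve. all: by end_near. Qed.

Lemma tangent_at_hyp B q v : B `<=` hyp -> tangent_at B q v -> mink q v = 0.
Proof.
move=> Bhyp [c [c0 Bc [dc vc]]].
have [h1 h2 h3 h4] := is_diff_co dc.
rewrite -c0 -vc -derive1E.
have hm := is_diff_add (is_diff_add (is_diff_add (is_diff_sqr h1) (is_diff_sqr h2))
  (is_diff_sqr h3)) (is_diff_opp (is_diff_sqr h4)).
have /(is_diff_near_const hm) : \forall y \near (0 : R),
    co1 (c y) ^+ 2 + co2 (c y) ^+ 2 + co3 (c y) ^+ 2 - co4 (c y) ^+ 2 = -1.
  by apply: filterS Bc => y /Bhyp [] /=; rewrite /mink; lra.
by rewrite /mink; lra.
Qed.

Lemma tangent_at_quadratic B q v (k1 k4 k : R) :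
  (forall y, B y -> k1 * co1 y ^+ 2 + k4 * co4 y ^+ 2 = k) ->
  tangent_at B q v -> k1 * (co1 q * co1 v) + k4 * (co4 q * co4 v) = 0.
Proof.
move=> Bk [c [c0 Bc [dc vc]]].
have [h1 h2 h3 h4] := is_diff_co dc.
rewrite -c0 -vc -derive1E.
have hm := is_diff_add (is_diff_mul (is_diff_const k1 0) (is_diff_sqr h1))
  (is_diff_mul (is_diff_const k4 0) (is_diff_sqr h4)).
have /(is_diff_near_const hm) : \forall y \near (0 : R),
    k1 * co1 (c y) ^+ 2 + k4 * co4 (c y) ^+ 2 = k.
  by apply: filterS Bc => y /Bk.
by lra.
Qed.

End Cone.

(** * Equations of the confocal quadrics *)

Section Confocal.
Context {R : realType}.
Variable a : R.
Hypothesis a2_lt1 : 0 < 1 - a ^+ 2.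
Implicit Types (q v w : 'rV[R]_4) (Q : set 'rV[R]_4).
Let s := Num.sqrt (1 - a ^+ 2).

Let s_gt0 : 0 < s. Proof. by rewrite sqrtr_gt0. Qed.
Let s_sqr : s ^+ 2 = 1 - a ^+ 2. Proof. by rewrite sqr_sqrtr // ltW. Qed.

Lemma mink_Z1E q : - mink q (Z1 a) = (- co4 q - a * co1 q) / s.
Proof. by rewrite /mink /Z1 !co_vec4 -/s; field; rewrite gt_eqF. Qed.

Lemma mink_Z2E q : - mink q (Z2 a) = (- co4 q + a * co1 q) / s.
Proof. by rewrite /mink /Z2 !co_vec4 -/s; field; rewrite gt_eqF. Qed.

Lemma mink_Z1_ge1 q : hyp q -> 1 <= - mink q (Z1 a).
Proof. by move=> /chartK <-; rewrite mink_Z1 ?coshZ_ge1. Qed.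

Lemma mink_Z2_ge1 q : hyp q -> 1 <= - mink q (Z2 a).
Proof. by move=> /chartK <-; rewrite -Z1N mink_Z1 ?coshZ_ge1 // sqrrN. Qed.

(* With [C = cosh c], both kinds of confocal quadrics of parameter [c] are cut
   out of the hyperboloid by [confocal_form C = 0]. *)
Definition confocal_form (C : R) q : R :=
  2 * a ^+ 2 * (C + 1) * co1 q ^+ 2 - 2 * (C - 1) * co4 q ^+ 2
  + (1 - a ^+ 2) * (C ^+ 2 - 1).

(** With [u1], [u2] the hyperbolic cosines of the distances to the centers, the bracket is the
    squared form of [cosh (theta1 +- theta2) = C]; its quartic terms cancel. *)
Lemma confocal_formE (C : R) q :
  let u1 := - mink q (Z1 a) in let u2 := - mink q (Z2 a) in
  (1 - a ^+ 2) * ((u1 * u2 - C) ^+ 2 - (u1 ^+ 2 - 1) * (u2 ^+ 2 - 1))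
  = confocal_form C q.
Proof.
rewrite /= mink_Z1E mink_Z2E /confocal_form -s_sqr; field.
by rewrite gt_eqF.
Qed.

(** The hyperbolic cosine of the focal distance, by [cosh_focal_distance]. *)
Let D : R := (1 + a ^+ 2) / (1 - a ^+ 2).

(** Recovers the sign lost by squaring. Writing [q1^2 = (C - 1) t], the inequality
    [1 + q1^2 <= q4^2] forces [(C - D) (1 - 2 t) >= 0], while [C - u] is [(C - D) / 2] plus a
    nonnegative multiple of [1 - 2 t]. *)
Lemma confocal_form_sign (C : R) q : hyp q -> 1 < C -> confocal_form C q = 0 ->
  let u := mink q (Z1 a) * mink q (Z2 a) in
  (D < C -> u < C) /\ (C < D -> C < u).
Proof.
move=> [hq _] C1 cf /=.
have C10 : 0 < C - 1 by rewrite subr_gt0.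
set t := co1 q ^+ 2 / (C - 1).
have q1 : co1 q ^+ 2 = (C - 1) * t by rewrite /t; field; rewrite gt_eqF.
have q4 : co4 q ^+ 2 = (C + 1) / 2 * (1 - a ^+ 2 + 2 * a ^+ 2 * t).
  apply: (mulfI (lt0r_neq0 C10)); move: cf; rewrite /confocal_form q1 => cf.
  by lra.
have uE : mink q (Z1 a) * mink q (Z2 a) =
    (C + 1) / 2 + 2 * a ^+ 2 * t / (1 - a ^+ 2).
  transitivity ((co4 q ^+ 2 - a ^+ 2 * co1 q ^+ 2) / s ^+ 2).
    rewrite -mulrNN mink_Z1E mink_Z2E; field; by rewrite gt_eqF.
  by rewrite s_sqr q4 q1; field; rewrite gt_eqF.
have q41 : 1 + co1 q ^+ 2 <= co4 q ^+ 2.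
  have := sqr_ge0 (co2 q); have := sqr_ge0 (co3 q).
  by move: hq; rewrite /mink; lra.
have sD : (1 - a ^+ 2) * D = 1 + a ^+ 2 by rewrite /D; field; rewrite gt_eqF.
have key : 0 <= (C - D) * (1 - 2 * t).
  rewrite -(pmulr_rge0 _ a2_lt1).
  rewrite (_ : _ * _ = ((1 - a ^+ 2) * C - (1 - a ^+ 2) * D) * (1 - 2 * t)); last by ring.
  by move: q41; rewrite q4 q1 sD; lra.
have uC : C - mink q (Z1 a) * mink q (Z2 a) =
    (C - D) / 2 + a ^+ 2 / (1 - a ^+ 2) * (1 - 2 * t).
  by rewrite uE /D; field; rewrite gt_eqF.
have ka : 0 <= a ^+ 2 / (1 - a ^+ 2) by rewrite divr_ge0 ?sqr_ge0 // ltW.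
split=> [DC|CD].
- rewrite -subr_gt0 uC ltr_pwDl ?divr_gt0 ?subr_gt0 // mulr_ge0 //.
  by move: key; rewrite pmulr_rge0 // subr_gt0.
- rewrite -subr_lt0 uC -oppr_gt0 opprD -mulNr opprB ltr_pwDl ?divr_gt0 ?subr_gt0 //.
  rewrite -mulrN mulr_ge0 // oppr_ge0.
  by move: key; rewrite nmulr_rge0 // subr_lt0.
Qed.

Lemma cosh_focal_distance : cosh (focal_distance a) = D /\ 0 <= focal_distance a.
Proof.
have hZ1 : hyp (Z1 a).
  split; last by rewrite /Z1 co_vec4 -/s oppr_lt0 divr_gt0.
  rewrite /mink /Z1 !co_vec4 -/s.
  transitivity ((a ^+ 2 - 1) / s ^+ 2); first by field; rewrite gt_eqF.
  by rewrite s_sqr; field; rewrite gt_eqF.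
have hZ2 : hyp (Z2 a).
  split; last by rewrite /Z2 co_vec4 -/s oppr_lt0 divr_gt0.
  rewrite /mink /Z2 !co_vec4 -/s.
  transitivity ((a ^+ 2 - 1) / s ^+ 2); first by field; rewrite gt_eqF.
  by rewrite s_sqr; field; rewrite gt_eqF.
rewrite /focal_distance /theta arcosh_ge0 ?cosh_arcosh ?mink_Z1_ge1 //; split => //.
rewrite mink_Z1E /Z2 !co_vec4 -/s /D -s_sqr.
transitivity ((1 + a ^+ 2) / s ^+ 2); first by field; rewrite gt_eqF.
by [].
Qed.

Lemma confocal_quadricE Q : confocal a Q -> exists C : R,
  [/\ 1 < C, C != D & Q = [set q | hyp q /\ confocal_form C q = 0]].
Proof.
have [cD d0] := cosh_focal_distance.
have Cgt1 c : 0 < c -> 1 < cosh c :> R.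
  move=> c0; have := cosh_lt (lexx 0) c0.
  by rewrite {1}/cosh oppr0 expR0 (_ : (1 + 1) / 2 = 1) //; field.
have sq C q : hyp q -> confocal_form C q = 0 <->
    (- mink q (Z1 a) * - mink q (Z2 a) - C) ^+ 2 =
    (sinh (theta (Z1 a) q) * sinh (theta (Z2 a) q)) ^+ 2.
  move=> hq; rewrite exprMn /theta !sinh_arcosh ?mink_Z1_ge1 ?mink_Z2_ge1 //.
  rewrite !sqr_sqrtr ?sqr_sub1_ge0 ?mink_Z1_ge1 ?mink_Z2_ge1 //.
  rewrite -confocal_formE /=; split=> [/eqP|->]; last by rewrite subrr mulr0.
  by rewrite mulf_eq0 gt_eqF //= subr_eq0 => /eqP.
have sh0 Z q : 1 <= - mink q Z -> 0 <= sinh (theta Z q).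
  by move=> h; rewrite sinh_arcosh // sqrtr_ge0.
have ch Z q : 1 <= - mink q Z -> cosh (theta Z q) = - mink q Z.
  by move=> h; rewrite cosh_arcosh.
move=> [_ [[c [dc ->]]|[c [/andP[c0 cd] ->]]]].
- have c0 := le_lt_trans d0 dc.
  have DC : D < cosh c by rewrite -cD cosh_lt.
  exists (cosh c); split; [exact: Cgt1 | by rewrite gt_eqF |].
  apply/seteqP; split=> q [hq h]; split => //.
  + apply/sq => //; rewrite -h coshD !ch ?mink_Z1_ge1 ?mink_Z2_ge1 //.
    by ring.
  + have u1 := mink_Z1_ge1 hq; have u2 := mink_Z2_ge1 hq.
    have [/(_ DC) lt_uC _] := confocal_form_sign hq (Cgt1 _ c0) h.
    apply: cosh_inj; rewrite ?addr_ge0 ?arcosh_ge0 ?(ltW c0) // coshD !ch //.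
    (* The sign belonging to the difference of distances would make [u - C] a product of two
       nonnegative [sinh], against [u < C]. The hyperboloid case below is symmetric. *)
    move/sq : h => /(_ hq)/eqP; rewrite eqf_sqr => /orP[]/eqP e.
      have := mulr_ge0 (sh0 _ _ u1) (sh0 _ _ u2).
      by rewrite -e mulrNN subr_ge0 leNgt lt_uC.
    by apply/eqP; rewrite -subr_eq0 addrAC e addNr.
- have CD : cosh c < D by rewrite -cD cosh_lt // ltW.
  exists (cosh c); split; [exact: Cgt1 | by rewrite lt_eqF |].
  apply/seteqP; split=> q [hq h]; split => //.
  + apply/sq => //; rewrite -h cosh_norm coshD coshN sinhN.
    rewrite !ch ?mink_Z1_ge1 ?mink_Z2_ge1 //.
    by ring.
  + have u1 := mink_Z1_ge1 hq; have u2 := mink_Z2_ge1 hq.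
    have [_ /(_ CD) lt_Cu] := confocal_form_sign hq (Cgt1 _ c0) h.
    apply: cosh_inj; rewrite ?normr_ge0 ?(ltW c0) // cosh_norm coshD coshN sinhN !ch //.
    move/sq : h => /(_ hq)/eqP; rewrite eqf_sqr => /orP[]/eqP e.
      by apply/eqP; rewrite -subr_eq0 addrAC e mulrN subrr.
    have := mulr_ge0 (sh0 _ _ u1) (sh0 _ _ u2).
    by rewrite -oppr_le0 -e mulrNN subr_le0 leNgt lt_Cu.
Qed.

(** The symmetry about [ZHooke] changes the signs of [q1], [q2], [q3] only, and the form is even in
    [q1]. *)
Lemma confocal_centered Q : confocal a Q -> centered_at ZHooke Q.
Proof.
move=> /confocal_quadricE [C [_ _ ->]] q [[hq q4] cf].
have e : - q - (2 * mink q ZHooke) *: ZHooke = vec4 (- co1 q) (- co2 q) (- co3 q) (co4 q).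
  rewrite {1}[q]vec4_eta /mink /ZHooke !co_vec4; apply/rowP => -[[|[|[|[|//]]]] hi];
    by rewrite !mxE /=; ring.
rewrite e; split; first split.
- by rewrite /mink !co_vec4 -hq /mink; ring.
- by rewrite /= co_vec4.
- by rewrite -cf /confocal_form !co_vec4 sqrrN.
Qed.

End Confocal.

(** * Invariance of the integrals under reflection *)

Section Reflection.
Context {R : realType}.
Variable a : R.
Hypothesis a2_lt1 : 0 < 1 - a ^+ 2.
Implicit Types (q v w n : 'rV[R]_4).

Variable C : R.
Hypothesis C_gt1 : 1 < C.
Hypothesis C_neq : C != (1 + a ^+ 2) / (1 - a ^+ 2).
Let B : set 'rV[R]_4 := [set q | hyp q /\ confocal_form a C q = 0].

Lemma confocal_tangent q w : B q -> mink q w = 0 ->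
  a ^+ 2 * (C + 1) * (co1 q * co1 w) = (C - 1) * (co4 q * co4 w) ->
  tangent_at B q w.
Proof.
move=> [hq cf] qw cw.
(* Subtracting [k2 (<q, q> + 1)] from [confocal_form] makes it homogeneous, so that the quadric is a
   cone section; [g] is nonzero because [C] differs from 1 and from the hyperbolic cosine of the
   focal distance. *)
pose g := (1 - a ^+ 2) * (C ^+ 2 - 1) - 2 * (C - 1).
pose k1 := (1 - a ^+ 2) * (C ^+ 2 - 1) - 2 * a ^+ 2 * (C + 1).
pose k2 := (1 - a ^+ 2) * (C ^+ 2 - 1).
have formE y : hyp y -> g * co4 y ^+ 2 - (k1 * co1 y ^+ 2 + k2 * (co2 y ^+ 2 + co3 y ^+ 2))
    = confocal_form a C y.
  move=> [hy _]; transitivity (confocal_form a C y - k2 * (mink y y + 1)).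
    by rewrite /confocal_form /mink /g /k1 /k2; ring.
  by rewrite hy addNr mulr0 subr0.
apply: (@tangent_cone _ _ g k1 k2) => //.
- have -> : g = (C - 1) * ((1 - a ^+ 2) * (C - (1 + a ^+ 2) / (1 - a ^+ 2))).
    by rewrite /g; field; rewrite gt_eqF.
  rewrite !mulf_neq0 ?(gt_eqF a2_lt1) // subr_eq0 //.
  by rewrite gt_eqF.
- by move=> y hy e; split => //; rewrite -formE // e subrr.
- by apply/eqP; rewrite -subr_eq0 formE // cf.
- apply/eqP; rewrite -subr_eq0; apply/eqP.
  transitivity (2 * (a ^+ 2 * (C + 1) * (co1 q * co1 w) - (C - 1) * (co4 q * co4 w))
    - k2 * mink q w); first by rewrite /g /k1 /k2 /mink; ring.
  by rewrite cw qw subrr !mulr0 subrr.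
Qed.

(** Polar form of twice the kinetic part of [projective_energy]. *)
Definition projective_form q v n : R :=
  (co4 q * co1 v - co1 q * co4 v) * (co4 q * co1 n - co1 q * co4 n) / (1 - a ^+ 2)
  + (co4 q * co2 v - co2 q * co4 v) * (co4 q * co2 n - co2 q * co4 n)
  + (co4 q * co3 v - co3 q * co4 v) * (co4 q * co3 n - co3 q * co4 n).

(* The endomorphism representing [projective_form] with respect to the metric
   preserves the tangent spaces of the confocal quadrics. *)
Lemma projective_form_normal q v n : B q -> tangent_at B q v -> normal_at B q n ->
  projective_form q v n = 0.
Proof.
move=> Bq tv [_ nn]; have [hq cf] := Bq.
have qv : mink q v = 0 by apply: tangent_at_hyp tv => y [].
have cv : a ^+ 2 * (C + 1) * (co1 q * co1 v) = (C - 1) * (co4 q * co4 v).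
  have : 2 * a ^+ 2 * (C + 1) * (co1 q * co1 v) + - (2 * (C - 1)) * (co4 q * co4 v) = 0.
    apply: (tangent_at_quadratic (k := - ((1 - a ^+ 2) * (C ^+ 2 - 1)))) tv.
    by move=> y [_]; rewrite /confocal_form; lra.
  by lra.
have aN0 : 1 - a ^+ 2 != 0 by rewrite gt_eqF.
pose b1 := (co4 q * co1 v - co1 q * co4 v) / (1 - a ^+ 2).
pose b2 := co4 q * co2 v - co2 q * co4 v.
pose b3 := co4 q * co3 v - co3 q * co4 v.
(* [w] is the image of [v] under the endomorphism; it remains to see that it is tangent to the
   quadric. *)
pose w := vec4 (co4 q * b1) (co4 q * b2) (co4 q * b3)
  (co1 q * b1 + co2 q * b2 + co3 q * b3).
have -> : projective_form q v n = mink n w.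
  by rewrite /projective_form /w /mink !co_vec4 /b1 /b2 /b3; field.
apply: nn; apply: confocal_tangent => //.
  by rewrite /mink /w !co_vec4; ring.
rewrite /w !co_vec4.
have -> : co1 q * b1 + co2 q * b2 + co3 q * b3 = a ^+ 2 * (co1 q * b1) + co4 v.
  apply/eqP; rewrite -subr_eq0; apply/eqP.
  transitivity (co4 q * mink q v - co4 v * (mink q q + 1)).
    by rewrite /b1 /b2 /b3 /mink; field.
  by rewrite qv (hq.1) addNr !mulr0 subrr.
(* Consequence of the tangency of [v] and the equation of the quadric at [q]. By it, both sides of
   the linearized equation for [w] become [(C^2 - 1) q4 v4 / 2]. *)
have e : 2 * a ^+ 2 * (co1 q * b1) = (C - 1) * co4 v.
  have C10 : C + 1 != 0 by rewrite gt_eqF // addr_gt0 // (lt_trans ltr01).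
  apply: (mulfI (mulf_neq0 C10 aN0)).
  transitivity (2 * co4 q * (a ^+ 2 * (C + 1) * (co1 q * co1 v))
    - 2 * a ^+ 2 * (C + 1) * co1 q ^+ 2 * co4 v).
    by rewrite /b1; field.
  rewrite cv.
  transitivity (co4 v * ((1 - a ^+ 2) * (C ^+ 2 - 1)) - co4 v * confocal_form a C q).
    by rewrite /confocal_form; ring.
  by rewrite cf mulr0 subr0; ring.
transitivity (co4 q * (C + 1) / 2 * (2 * a ^+ 2 * (co1 q * b1))); first by field.
rewrite e.
transitivity (co4 q * (C - 1) / 2 * ((2 * a ^+ 2 * (co1 q * b1)) + 2 * co4 v)).
  by rewrite e; field.
by field.
Qed.

(** The quadric is invariant under rotations about the first axis, so the rotation field is tangent
    to it; pairing [n] with this field gives [L_yz q n]. *)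
Lemma L_yz_normal q n : B q -> normal_at B q n -> L_yz q n = 0.
Proof.
move=> Bq [_ nn].
have <- : mink n (vec4 0 (co3 q) (- co2 q) 0) = L_yz q n.
  by rewrite /mink !co_vec4 /L_yz; ring.
apply: nn; apply: confocal_tangent => //; rewrite /mink !co_vec4; ring.
Qed.

(** For the two quadratic integrals the difference between [t + n] and [t - n] is a multiple of the
    polar form at [t] and [n]; for the linear [L_yz] it is twice the value at [n]. All of these
    vanish. *)
Lemma reflection_invariant_confocal (U V : 'rV[R]_4 -> R) (i : 'I_3) q v v' :
  B q -> reflection B q v v' ->
  nth (@L_yz R) [:: mechanical_energy U; projective_energy a V; @L_yz R] i q v
  = nth (@L_yz R) [:: mechanical_energy U; projective_energy a V; @L_yz R] i q v'.
Proof.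
move=> Bq [t [n [tt nn -> ->]]]; have [hq _] := Bq.
have qt : mink q t = 0 by apply: tangent_at_hyp tt => y [].
have [qn tn] := nn; have nt := tn _ tt; rewrite /tangent_hyp in qn.
have coD x y : (co1 (x + y) = co1 x + co1 y) * (co2 (x + y) = co2 x + co2 y) *
    (co3 (x + y) = co3 x + co3 y) * (co4 (x + y) = co4 x + co4 y).
  by rewrite /co1 /co2 /co3 /co4 !mxE.
have coN x : (co1 (- x) = - co1 x) * (co2 (- x) = - co2 x) * (co3 (- x) = - co3 x)
    * (co4 (- x) = - co4 x).
  by rewrite /co1 /co2 /co3 /co4 !mxE.
have minkD x y z : mink x (y + z) = mink x y + mink x z.
  by rewrite /mink !coD; ring.
have minkN x y : mink x (- y) = - mink x y by rewrite /mink !coN; ring.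
move: i; apply: ord3_ind => /=.
- rewrite /mechanical_energy /normH !sqr_sqrtr; last first.
  + by apply: (mink_tangent_ge0 hq); rewrite minkD qt qn addr0.
  + by apply: (mink_tangent_ge0 hq); rewrite minkD minkN qt qn subr0.
  rewrite !minkD !minkN [mink (t + n) _]minkC [mink (t + n) n]minkC.
  rewrite [mink (t - n) t]minkC [mink (t - n) n]minkC !minkD !minkN.
  by rewrite [mink t n]minkC nt; ring.
- have := projective_form_normal Bq tt nn; rewrite /projective_form => pf.
  apply/eqP; rewrite -subr_eq0; apply/eqP.
  rewrite /projective_energy !coD !coN -[RHS](mulr0 2) -pf.
  by field; rewrite gt_eqF.
- have := L_yz_normal Bq nn; rewrite /L_yz !coD !coN => Ln.
  apply/eqP; rewrite -subr_eq0; apply/eqP; rewrite -[RHS](mulr0 2) -Ln.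
  by ring.
Qed.

End Reflection.

(** * Integrability of the Lagrange billiard and of its subcases *)

Section Integrability.
Context {R : realType}.
Variable a : R.
Hypothesis a2_lt1 : 0 < 1 - a ^+ 2.

Lemma lagrange_sing_axis (mh1 mh2 : R) x : lagrange_sing a mh1 mh2 (chart x) ->
  ch2 x ^+ 2 + ch3 x ^+ 2 = 0.
Proof.
have e : ch2 x = co2 (chart x) /\ ch3 x = co3 (chart x) by rewrite chartE !co_vec4.
case: e => -> ->; by case=> -[_ ->]; rewrite !co_vec4; ring.
Qed.

Lemma lagrange_billiard (mh1 mh2 f : R) (W : set (set 'rV[R]_4)) :
  (forall Q, W Q -> confocal a Q) ->
  billiard_integrable_by (lagrange_force a mh1 mh2 f) (lagrange_sing a mh1 mh2) W
    (lagrange_integrals a mh1 mh2 f).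
Proof.
move=> confW.
have dual x : ~ lagrange_sing a mh1 mh2 (chart x) -> dual_potentials a _ _ x :=
  dual_potentials_lagrange a2_lt1 f (x := x).
rewrite (funext (lagrange_integralsE a mh1 mh2 f)); split.
- by move=> i; exact: first_integral_dual.
- apply: functionally_independent_dual => //; exact: lagrange_sing_axis.
- move=> i j z /dual dz; move: i; apply: ord3_ind; move: j; apply: ord3_ind => /=;
  rewrite ?poisson_self // ?(poisson_energies a2_lt1 dz) ?(poisson_mechanical_L dz)
    ?(poisson_projective_L a2_lt1 dz) // poissonC
    ?(poisson_energies a2_lt1 dz) ?(poisson_mechanical_L dz)
    ?(poisson_projective_L a2_lt1 dz) oppr0 //.
- move=> i Q /confW /(confocal_quadricE a2_lt1) [C [C1 CD ->]] q Bq _ v v'.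
  exact: reflection_invariant_confocal.
Qed.

End Integrability.

Theorem theorem4 (R : realType) (a mh1 mh2 f : R) (W : set (set 'rV[R]_4))
    (ha : 0 < `|a| < 1) (finW : finite_set W)
    (confW : forall Q, W Q -> confocal a Q) :
  [/\ (* the Lagrange problem *)
      billiard_integrable (lagrange_force a mh1 mh2 f) (lagrange_sing a mh1 mh2) W,
      billiard_integrable_by (lagrange_force a mh1 mh2 f) (lagrange_sing a mh1 mh2) W
        (lagrange_integrals a mh1 mh2 f),
      (* the two-center problem *)
      billiard_integrable_by (two_center_force a mh1 mh2) (lagrange_sing a mh1 mh2) W
        (lagrange_integrals a mh1 mh2 0),
      (* the Kepler problem at either focus *)
      billiard_integrable_by (kepler_force (Z1 a) mh1) (kepler_sing (Z1 a) mh1) W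
        (lagrange_integrals a mh1 0 0) /\
      billiard_integrable_by (kepler_force (Z2 a) mh2) (kepler_sing (Z2 a) mh2) W
        (lagrange_integrals a 0 mh2 0)
    & (* the Hooke problem *)
      billiard_integrable_by (hooke_force f) set0 W (lagrange_integrals a 0 0 f) /\
      forall Q, W Q -> centered_at ZHooke Q].
Proof.
have a2_lt1 : 0 < 1 - a ^+ 2.
  by case/andP: ha => _ a1; rewrite subr_gt0 -real_normK ?num_real // expr_lt1.
have main k1 k2 k := lagrange_billiard a2_lt1 k1 k2 k confW.
(* Each subcase is the Lagrange problem with some parameters zero: the force functions agree
   everywhere, and a center of zero mass adds no singularity. *)
have two_center k1 k2 : two_center_force a k1 k2 = lagrange_force a k1 k2 0.
  by apply/funext => q; rewrite /lagrange_force /hooke_force mul0r addr0.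
have kepler1 k : kepler_force (Z1 a) k = lagrange_force a k 0 0.
  by apply/funext => q; rewrite -two_center /two_center_force [X in _ + X]mul0r addr0.
have kepler2 k : kepler_force (Z2 a) k = lagrange_force a 0 k 0.
  by apply/funext => q; rewrite -two_center /two_center_force [X in X + _]mul0r add0r.
have hooke : hooke_force f = lagrange_force a 0 0 f.
  apply/funext => q; rewrite /lagrange_force [X in X + _ + _]mul0r [X in _ + X + _]mul0r.
  by rewrite !add0r.
have sing0 (Z : 'rV[R]_4) : kepler_sing Z (0 : R) = set0.
  by apply/seteqP; split=> q // []; rewrite eqxx.
have sing1 k : kepler_sing (Z1 a) k = lagrange_sing a k 0.
  by rewrite /lagrange_sing sing0 setU0.
have sing2 k : kepler_sing (Z2 a) k = lagrange_sing a 0 k.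
  by rewrite /lagrange_sing sing0 set0U.
have sing : set0 = lagrange_sing a 0 0 by rewrite -sing1 sing0.
split.
- by exists (lagrange_integrals a mh1 mh2 f).
- exact: main.
- by rewrite two_center.
- by rewrite kepler1 kepler2 sing1 sing2.
- by rewrite hooke sing; split => // Q /confW; exact: confocal_centered.
Qed.
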